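(* Let $\mathcal I(K_n)$ be the smallest magic sum $s$ over all edge-magic injections of the complete graph $K_n$. Then $$\mathcal I(K_n)\le \left(\frac{288}{121}+o(1)\right) n^2 \qquad (n\to\infty).$$
   Context: An edge-magic injection of a graph $G$ (with $V(G)\cap E(G)=\emptyset$) is an injective map $l:V(G)\cup E(G)\to\mathbb Z_{>0}$ such that for every edge $ab\in E(G)$ the sum $l(a)+l(b)+l(ab)$ equals a constant $s$ (the magic sum), independent of the edge. *)

(* Defs.v *)
From mathcomp Require Import all_boot all_order all_algebra.
Set Implicit Arguments. Unset Strict Implicit. Unset Printing Implicit Defensive.

(* A simple graph is a symmetric irreflexive relation [e] on a finType [T];
   its edges are the two-element sets {x, y} with [e x y]. *)
Definition edges (T : finType) (e : rel T) : {set {set T}} :=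
  [set E : {set T} | [exists x, exists y, e x y && (E == [set x; y])]].

Definition edge_magic_injection (T : finType) (e : rel T)
    (lv : T -> nat) (le : {set T} -> nat) (s : nat) : Prop :=
  (forall x, 0 < lv x) /\
  (forall E, E \in edges e -> 0 < le E) /\
  injective lv /\
  {in edges e &, injective le} /\
  (forall x E, E \in edges e -> lv x <> le E) /\
  (forall x y, e x y -> lv x + lv y + le [set x; y] = s).

Definition complete_graph (n : nat) : rel 'I_n := fun x y => x != y.
Arguments complete_graph n : clear implicits.

(* Main.v *)
(* Let q be a prime power and N = q^2 - 1.  Bose's construction gives q residues
   mod N with pairwise distinct sums of two.  Put a translate of them in [1, N]
   as vertex labels: with magic sum s >= 2 N the edge labels s - a - b are
   positive and distinct, and one clashes with a vertex label only when
   a + b + c = s for three labels.  There are about q^3/6 multisets {a, b, c};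
   averaging over the translate and over six values of s near N and 2 N leaves
   about q/12 of them with sum s, and the reflection b -> N + 1 - b brings s above
   2 N.  Deleting one label from each leaves n ~ 11 q/12 vertices with
   s ~ 2 q^2 ~ 2 (12/11)^2 n^2.

   To reach every n one needs a prime power in (y, (1 + 1/d) y] for all large y.
   This is Erdos' consequence of Selberg's formula
     psi(x) log x + sum_n Lambda(n) psi(x/n) = 2 x log x + O(x),
   which bounds the density of Lambda by 2.  Call a ratio lam bad if psi grows
   by o(y) on (y, lam y] for some arbitrarily large y.  If bad ratios exist, pick
   lam bad with (1 + small) lam not bad, and a nearly empty interval (x, z] with
   z = lam x.  Selberg's formula then forces nearly all prime powers n (in
   logarithmic measure) to have density about 2 in (x/n, z/n].  Since every
   interval of ratio (1 + small) lam holds a positive proportion of prime powers,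
   some chain of such n has intervals (x/n, z/n] that almost cover (0, v] for
   a large v, so psi(v) is close to 2 v, against Chebyshev's bound 7/4 v + O(1). *)

Require Import Defs.
From mathcomp Require Import boolp classical_sets reals sequences exp Rstruct.
From mathcomp Require Import all_boot all_order all_algebra fingroup cyclic finfield.
From mathcomp Require Import zify ring lra.
Set Implicit Arguments. Unset Strict Implicit. Unset Printing Implicit Defensive.
Import Order.TTheory GRing.Theory Num.Theory.
Local Open Scope ring_scope.

(** * Bose's Sidon sets and labels of complete graphs *)

(** For a generator [th] of the unit group of GF(q^2), [f i] is the discrete logarithm of
    [th + ka i], with [ka i] running over GF(q). Equal sums give (th + a)(th + b) = (th + a')(th +
    b'); as [th] lies outside GF(q), the coefficients of the difference vanish and {a, b} = {a',
    b'}. *)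
Lemma bose_sidon (p k : nat) : prime p -> (0 < k)%N ->
  exists f : 'I_(p ^ k) -> nat, forall i j i' j' : 'I_(p ^ k),
    (f i + f j = f i' + f j' %[mod (p ^ k) ^ 2 - 1])%N ->
    i = i' /\ j = j' \/ i = j' /\ j = i'.
Proof.
move=> pr_p k_gt0; set q := (p ^ k)%N.
have q_gt1 : (1 < q)%N by rewrite -(exp1n k) ltn_exp2r // prime_gt1.
have k2_gt0 : (0 < k * 2)%N by rewrite muln_gt0 k_gt0.
have [F pF cardF] := pPrimePowerField pr_p k2_gt0.
have {}cardF : #|F| = (q ^ 2)%N by rewrite cardF expnM.
have qF : [pchar F].-nat q.
  by rewrite pnatX; apply/orP; left; rewrite pnatE.
have /cyclicP[u Du] := field_unit_group_cyclic [set: {unit F}].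
have ord_u : #[u]%g = (q ^ 2 - 1)%N.
  by rewrite orderE -Du card_finField_unit cardF subn1.
pose th : F := FinRing.uval u.
have thX n : FinRing.uval (u ^+ n)%g = th ^+ n by exact: FinRing.val_unitX.
have th_eq m n : (th ^+ m == th ^+ n) = (m == n %[mod q ^ 2 - 1])%N.
  by rewrite -ord_u -eq_expg_mod_order -!thX.
have frD (x y : F) : (x + y) ^+ q = x ^+ q + y ^+ q by exact: exprDn_pchar.
have frN (x : F) : (- x) ^+ q = - x ^+ q.
  by apply/eqP; rewrite -addr_eq0 -frD addNr expr0n gtn_eqF // ltnW.
have th_notin : th ^+ q != th.
  rewrite -{2}[th]expr1 th_eq !modn_small; first by lia.
    by move: q_gt1; nia.
  by move: q_gt1; nia.
(* The subfield GF(q): zero, and the powers of th^(q + 1) with exponents 1 to q - 1. *)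
pose ka (i : 'I_q) : F := if i == 0%N :> nat then 0 else th ^+ ((q + 1) * i).
have ka_fix i : ka i ^+ q = ka i.
  rewrite /ka; case: eqP => _; first by rewrite expr0n gtn_eqF // ltnW.
  apply/eqP; rewrite -exprM th_eq.
  have -> : ((q + 1) * i * q = i * (q ^ 2 - 1) + (q + 1) * i)%N.
    by move: q_gt1; nia.
  by rewrite modnMDl.
have th_unit : th != 0 by rewrite -unitfE; exact: (valP u).
have ka_inj : injective ka.
  move=> i j; rewrite /ka.
  case: eqP => [i0|/eqP i0]; case: eqP => [j0|/eqP j0] // e.
  - by apply/val_inj; rewrite /= i0 j0.
  - by move/eqP: e; rewrite eq_sym (negPf (expf_neq0 _ th_unit)).
  - by move/eqP: e; rewrite (negPf (expf_neq0 _ th_unit)).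
  move/eqP: e; rewrite th_eq => /eqP e; apply/val_inj => /=.
  have bound (a : 'I_q) : a != 0%N :> nat ->
      ((q + 1) * a = (q + 1) * (a - 1) + (q + 1) /\
       (q + 1) * (a - 1) + (q + 1) <= q ^ 2 - 1)%N.
    by move=> a0; have := ltn_ord a; split; move: q_gt1; nia.
  have [] := bound i i0; have [] := bound j j0.
  (* Index q - 1 has exponent q^2 - 1, the modulus itself; lowering all exponents by one brings them
     below it. *)
  have pos (a : 'I_q) : ((q + 1) * (a - 1) + q < q ^ 2 - 1)%N.
    by have := ltn_ord a; move: q_gt1; nia.
  move=> e1 _ e2 _; move: e.
  have -> : ((q + 1) * i = (q + 1) * (i - 1) + q + 1)%N by lia.
  have -> : ((q + 1) * j = (q + 1) * (j - 1) + q + 1)%N by lia.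
  move/eqP; rewrite eqn_modDr => /eqP; rewrite !modn_small ?pos // => e.
  have : ((q + 1) * (i - 1) = (q + 1) * (j - 1))%N by lia.
  move/eqP; rewrite eqn_mul2l addn1 /= => /eqP ?; lia.
have nz i : th + ka i != 0.
  apply: contra th_notin; rewrite addr_eq0 => /eqP ->.
  by rewrite frN ka_fix.
have log_ex i : exists n, th ^+ n == th + ka i.
  have /cycleP[n Dn] : finField_unit (nz i) \in <[u]>%g by rewrite -Du inE.
  by exists n; rewrite -thX -Dn.
pose f i := xchoose (log_ex i).
have fE i : th ^+ f i = th + ka i by apply/eqP; exact: xchooseP (log_ex i).
exists f => i j i' j' /eqP; rewrite -th_eq !exprD !fE => /eqP e.
(* Both [c] and [d] are fixed by x -> x^q; if [c] were nonzero, th = d / c would be fixed too. *)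
pose c := ka i + ka j - ka i' - ka j'.
pose d := ka i' * ka j' - ka i * ka j.
have cd : th * c = d.
  have -> : th * c = (th + ka i) * (th + ka j) - (th + ka i') * (th + ka j') + d.
    by rewrite /c /d; ring.
  by rewrite e subrr add0r.
have frc : c ^+ q = c by rewrite /c !(frD, frN) !ka_fix.
have frd : d ^+ q = d by rewrite /d frD frN !exprMn !ka_fix.
have c0 : c = 0.
  apply/eqP; apply: contraNT th_notin => c0.
  have -> : th = d / c by rewrite -cd mulfK.
  by rewrite exprMn exprVn frc frd.
have d0 : d = 0 by rewrite -cd c0 mulr0.
have /eqP : (ka i - ka i') * (ka i - ka j') = 0.
  have -> : (ka i - ka i') * (ka i - ka j') = ka i * c + d by rewrite /c /d; ring.
  by rewrite c0 d0 mulr0 addr0.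
have jE : ka j = ka i' + ka j' - ka i.
  by rewrite -[LHS]subr0 -c0 /c; ring.
rewrite mulf_eq0 !subr_eq0 => /orP[] /eqP e1; [left|right]; move: jE; rewrite e1.
  by rewrite addrAC subrr add0r => /ka_inj ->; split => //; exact: ka_inj.
by rewrite addrK => /ka_inj ->; split => //; exact: ka_inj.
Qed.

(** Sorted tuples stand for multisets: repetitions matter, since an edge label may clash with the
    label of one of its own ends. *)
Definition sorted_triples (m : nat) (b : 'I_m -> nat) (s : nat) : {set 3.-tuple 'I_m} :=
  [set t : 3.-tuple 'I_m | sorted leq (map val t) & (\sum_(i <- t) b i == s)%N].

Lemma sum_triple (m : nat) (b : 'I_m -> nat) (t : 3.-tuple 'I_m) :
  (\sum_(i <- t) b i = b (tnth t ord0) + b (tnth t (inord 1)) + b (tnth t (inord 2)))%N.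
Proof.
rewrite big_tuple !big_ord_recl big_ord0 addn0 addnA.
by congr (_ + b (tnth t _) + b (tnth t _))%N; apply/val_inj; rewrite /= inordK.
Qed.

(** One index is deleted from every triple of sum [s], and an edge gets [s] minus its end labels.
    Edge labels are distinct by the Sidon property, and positive because two distinct labels sum to
    less than 2 N. *)
Lemma magic_of_labels (m N s n : nat) (b : 'I_m -> nat) :
  (forall i, 0 < b i <= N)%N ->
  (forall i j i' j', (b i + b j = b i' + b j')%N -> i = i' /\ j = j' \/ i = j' /\ j = i') ->
  (2 * N <= s)%N -> (n + #|sorted_triples b s| <= m)%N ->
  exists (lv : 'I_n -> nat) (le : {set 'I_n} -> nat),
    edge_magic_injection (complete_graph n) lv le s.
Proof.
move=> bN sidon sN hn.
have b_inj : injective b.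
  by move=> i j e; have := sidon i i j j; rewrite e => /(_ erefl) [] [].
pose bad := [set tnth t ord0 | t in sorted_triples b s].
have hG : (n <= #|~: bad|)%N.
  have : (#|bad| <= #|sorted_triples b s|)%N by exact: leq_imset_card.
  by have := cardsC bad; rewrite card_ord; lia.
pose g (x : 'I_n) : 'I_m := enum_val (widen_ord hG x).
have g_inj : injective g.
  by move=> x y /enum_val_inj /(congr1 val) /= /val_inj.
have g_good x : g x \notin bad by rewrite -in_setC; exact: enum_valP.
have no_sum x y z : (b (g x) + b (g y) + b (g z) <> s)%N.
  move=> e; pose r := relpre (val : 'I_m -> nat) leq.
  pose t := sort_tuple r [tuple g x; g y; g z].
  have r_tot : total r by move=> i j; exact: leq_total.
  have pt : perm_eq t [:: g x; g y; g z] by rewrite /= perm_sort.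
  have : tnth t ord0 \in bad.
    apply/imsetP; exists t => //; rewrite inE.
    apply/andP; split; first by rewrite sorted_map; exact: sort_sorted.
    by rewrite (perm_big _ pt) /= !big_cons big_nil addn0 addnA e.
  have : tnth t ord0 \in [:: g x; g y; g z] by rewrite -(perm_mem pt) mem_tnth.
  by rewrite !inE => /or3P[] /eqP ->; apply/negP.
pose lv x := b (g x).
pose le (E : {set 'I_n}) := (s - \sum_(x in E) lv x)%N.
have lv_inj : injective lv by move=> x y /b_inj /g_inj.
have lvN x : (0 < lv x <= N)%N by exact: bN.
have sum2 x y : x != y -> (\sum_(z in [set x; y]) lv z = lv x + lv y)%N.
  by move=> xy; rewrite big_setU1 ?inE // big_set1.
have lt2 x y : x != y -> (lv x + lv y < s)%N.
  move=> xy; have : lv x <> lv y by move/lv_inj/eqP; apply/negP.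
  by have := lvN x; have := lvN y; lia.
have edgeP E : E \in edges (complete_graph n) -> exists x y, x != y /\ E = [set x; y].
  by rewrite inE => /existsP[x /existsP[y /andP[xy /eqP ->]]]; exists x, y.
exists lv, le; split; first by move=> x; have /andP[] := lvN x.
split; first by move=> E /edgeP[x [y [xy ->]]]; rewrite /le sum2 // subn_gt0 lt2.
split=> //; split.
  move=> E E' /edgeP[x [y [xy ->]]] /edgeP[x' [y' [xy' ->]]].
  rewrite /le !sum2 // => e; have := lt2 _ _ xy; have := lt2 _ _ xy' => h1 h2.
  have /sidon : (b (g x) + b (g y) = b (g x') + b (g y'))%N by rewrite /lv in e h1 h2; lia.
  by case=> -[/g_inj -> /g_inj ->] //; rewrite setUC.
split.
  move=> x E /edgeP[y [z [yz ->]]]; rewrite /le sum2 // => e.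
  have := lt2 _ _ yz => h; apply: (no_sum y z x).
  by rewrite /lv in e h; lia.
by move=> x y xy; rewrite /le sum2 // subnKC // ltnW // lt2.
Qed.

Lemma card_sorted_triples_all (m : nat) :
  (6 * #|[set t : 3.-tuple 'I_m | sorted leq (map val t)]| = m * m.+1 * m.+2)%N.
Proof.
case: m => [|m].
  rewrite (_ : [set _ | _] = set0) ?cards0 //.
  by apply/setP => t; case: (tnth t ord0).
rewrite card_sorted_tuples mulnC; have := bin_ffact (3 + m) 3.
rewrite (_ : 3`! = 6)%N // => ->; rewrite !ffactnS ffactn0; lia.
Qed.

(* Each triple hits at most three of the [6 N] pairs (translate, target sum),
   since [3 tau - j] covers every residue mod [N] three times. *)
Lemma translate_few_triples (m N : nat) (f : 'I_m -> nat) :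
  (2 < m)%N -> N = (m ^ 2 - 1)%N ->
  exists (tau a j : nat), [/\ (a < 2)%N, (j < 3)%N &
    (12 * #|sorted_triples (fun i => 1 + (f i + tau) %% N)%N (a.+1 * N + j)%N| <= m + 4)%N].
Proof.
move=> m_gt2 NE.
have N_gt3 : (3 < N)%N by nia.
pose cnt (v : 'I_N * 'I_2 * 'I_3) :=
  #|sorted_triples (fun i => 1 + (f i + v.1.1) %% N)%N (v.1.2.+1 * N + v.2)%N|.
have [v hv|hcnt] := pickP (fun v => 12 * cnt v <= m + 4)%N.
  by exists v.1.1, v.1.2, v.2; split.
pose A := [set t : 3.-tuple 'I_m | sorted leq (map val t)].
pose hit (t : 3.-tuple 'I_m) (v : 'I_N * 'I_2 * 'I_3) :=
  (\sum_(i <- t) (1 + (f i + v.1.1) %% N) == v.1.2.+1 * N + v.2)%N.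
have cntE : (\sum_v cnt v = \sum_(t in A) #|[set v | hit t v]|)%N.
  under [RHS]eq_bigr do rewrite -sum1dep_card big_mkcond.
  rewrite exchange_big /=; apply: eq_bigr => v _.
  rewrite /cnt /sorted_triples -sum1dep_card -big_mkcondr /=.
  by apply: eq_bigl => t; rewrite inE.
have hit3 t : (#|[set v | hit t v]| <= 3)%N.
  (* The 2 keeps the value nonnegative. [u v] lies below 3 N and, as j < 3, determines tau and j. A
     hit fixes its residue mod N, so the quotient by N tells hits apart; the sum then fixes [a]. *)
  pose u (v : 'I_N * 'I_2 * 'I_3) := (3 * v.1.1 + (2 - v.2))%N.
  have uN v : (u v < 3 * N)%N by rewrite /u; have := ltn_ord v.1.1; lia.
  have uN3 v : (u v %/ N < 3)%N by rewrite ltn_divLR //; lia.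
  pose h v : 'I_3 := Ordinal (uN3 v).
  rewrite -(card_in_imset (f := h)); first by rewrite -[X in (_ <= X)%N]card_ord max_card.
  have umod v : v \in [set v | hit t v] -> (u v + (\sum_(i <- t) f i + 1) = 0 %[mod N])%N.
    rewrite inE /hit !sum_triple => /eqP e.
    move: e => /=; set x := f _; set y := f _; set z := f _; set tau := (v.1.1 : nat) => e.
    have := divn_eq (x + tau) N; have := divn_eq (y + tau) N; have := divn_eq (z + tau) N.
    move: e; set kx := ((x + _) %/ N)%N; set ky := ((y + _) %/ N)%N; set kz := ((z + _) %/ N)%N.
    move=> e ez ey ex; have jl := ltn_ord v.2.
    have -> : (u v + (x + y + z + 1) = (kx + ky + kz + v.1.2.+1) * N + 0)%N.
      rewrite /u -/tau; move: e ex ey ez; rewrite -!/tau !mulnDl.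
      move: ((x + _) %% N)%N ((y + _) %% N)%N ((z + _) %% N)%N => rx ry rz.
      clearbody tau x y z kx ky kz; move: jl; move: (nat_of_ord v.2) (v.1.2.+1 * N)%N.
      clear; move: (kx * N)%N (ky * N)%N (kz * N)%N. lia.
    by rewrite modnMDl.
  move=> v w hv hw /(congr1 val) /= ediv.
  have emod : (u v = u w %[mod N])%N.
    by apply/eqP; rewrite -(eqn_modDr (\sum_(i <- t) f i + 1)) (umod v hv) (umod w hw).
  have : u v = u w by rewrite (divn_eq (u v) N) (divn_eq (u w) N) ediv emod.
  move: hv hw; rewrite !inE /hit.
  case: v {umod ediv emod} => [[tv av] jv]; case: w => [[tw aw] jw]; rewrite /u /=.
  move=> e1 e2 e3.
  have jl := ltn_ord jv; have jl' := ltn_ord jw.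
  have ejj : jv = jw by apply/val_inj => /=; lia.
  have ett : tv = tw by apply/val_inj => /=; move: e3; rewrite ejj; lia.
  move: e1 e2; rewrite ejj ett => /eqP -> ; rewrite eqn_add2r eqn_mul2r => /orP[]; first by lia.
  by move/eqP => [] /val_inj ->.
(* If every count were too large, then 6 N (m + 5) <= 36 #|A| = 6 m (m + 1) (m + 2), that is (m - 1)
   (m + 5) <= m (m + 2), false for m > 2. *)
have : (\sum_(v : 'I_N * 'I_2 * 'I_3) (m + 5) <= 12 * \sum_v cnt v)%N.
  rewrite big_distrr; apply: leq_sum => v _.
  by have /negbT := hcnt v; rewrite -ltnNge /=; lia.
rewrite sum_nat_const !card_prod !card_ord cntE.
have : (\sum_(t in A) #|[set v | hit t v]| <= #|A| * 3)%N.
  by rewrite -sum_nat_const; apply: leq_sum.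
have := card_sorted_triples_all m; rewrite -/A.
move: (\sum_(t in A) _)%N #|A| => X a hA hX hN; exfalso.
have hm : (m * m.+2 < (m - 1) * (m + 5))%N by nia.
have : (N = m.+1 * (m - 1))%N by nia.
by move: hA hX hN hm; move: (m - 1)%N; clear; nia.
Qed.

(* Of a target sum below [2 N] and its mirror image under [b -> N + 1 - b],
   the mirror image is the one above [2 N]. *)
Lemma magic_of_prime_power (p k n : nat) :
  prime p -> (0 < k)%N -> (2 < p ^ k)%N -> (12 * n + 4 <= 11 * p ^ k)%N ->
  exists (lv : 'I_n -> nat) (le : {set 'I_n} -> nat) (s : nat),
    edge_magic_injection (complete_graph n) lv le s /\ (s <= 2 * (p ^ k) ^ 2 + 1)%N.
Proof.
move=> pr_p k_gt0; have [f] := bose_sidon pr_p k_gt0.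
move: (p ^ k)%N f => q f sidon q_gt2 hn.
have [tau [a [j [a2 j3]]]] := translate_few_triples f q_gt2 erefl.
set N := (q ^ 2 - 1)%N in sidon *; set b := fun i => _ => hcnt.
have N_gt3 : (3 < N)%N by rewrite /N; nia.
have bN i : (0 < b i <= N)%N by rewrite /b add1n ltn_pmod // (ltn_trans _ N_gt3).
have b_sidon i i' l l' : (b i + b i' = b l + b l')%N -> i = l /\ i' = l' \/ i = l' /\ i' = l.
  rewrite /b => e; apply: sidon.
  have {}e : (((f i + tau) %% N + (f i' + tau) %% N)%N = ((f l + tau) %% N + (f l' + tau) %% N)%N)%N by lia.
  apply/eqP; rewrite -(eqn_modDr (tau + tau)) !(addnACA _ _ tau tau); apply/eqP.
  by rewrite -modnDm e modnDm.
have sE : (2 * N + 3 = 2 * q ^ 2 + 1)%N by rewrite /N; nia.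
case: a a2 hcnt => [|[|//]] _ hcnt.
  (* Reflection sends the target N + j to 3 (N + 1) - (N + j) = 2 N + 3 - j, which exceeds 2 N
     because j < 3. *)
  pose b' i := (N + 1 - b i)%N.
  have [||||lv [le mg]] := @magic_of_labels q N (3 * N + 3 - (1 * N + j)) n b'.
  - by move=> i; rewrite /b'; have := bN i; lia.
  - move=> i i' l l' e; apply: b_sidon; move: e; rewrite /b'.
    by have := bN i; have := bN i'; have := bN l; have := bN l'; lia.
  - lia.
  - have -> : sorted_triples b' (3 * N + 3 - (1 * N + j)) = sorted_triples b (1 * N + j).
      apply/setP => t; rewrite !inE !sum_triple /b'; congr (_ && _).
      have := bN (tnth t ord0); have := bN (tnth t (inord 1)); have := bN (tnth t (inord 2)).
      move: (b _) (b _) (b _) => z y x hz hy hx.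
      by apply/eqP/eqP; lia.
    by lia.
  by exists lv, le, (3 * N + 3 - (1 * N + j))%N; split => //; lia.
have [||||lv [le mg]] := @magic_of_labels q N (2 * N + j) n b => //; try lia.
by exists lv, le, (2 * N + j)%N; split => //; lia.
Qed.

(** * Prime powers in short intervals *)

Section Arithmetic.
Variable R : realType.

Lemma sum_multiples (V : nmodType) (h : nat -> V) (d x : nat) : (0 < d)%N ->
  \sum_(1 <= n < x.+1 | (d %| n)%N) h (n %/ d)%N = \sum_(1 <= m < (x %/ d).+1) h m.
Proof.
move=> d_gt0; rewrite -big_filter.
have /(perm_big _)-> : perm_eq [seq n <- index_iota 1 x.+1 | (d %| n)%N]
    [seq (d * m)%N | m <- index_iota 1 (x %/ d).+1].
  apply: uniq_perm; first by rewrite filter_uniq // iota_uniq.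
    rewrite map_inj_uniq ?iota_uniq // => a b /eqP.
    by rewrite eqn_mul2l gtn_eqF //= => /eqP.
  move=> n; rewrite mem_filter mem_index_iota.
  apply/andP/mapP => [[/dvdnP[m ->] hm]|[m]].
    exists m; last by rewrite mulnC.
    rewrite mem_index_iota; move: hm; rewrite muln_gt0 !ltnS leq_divRL //.
    by case/andP => /andP[-> _].
  rewrite mem_index_iota => /andP[m1 m2] ->.
  rewrite dvdn_mulr // muln_gt0 d_gt0 m1 /= ltnS mulnC -leq_divRL //.
by rewrite big_map; apply: eq_bigr => m _; rewrite mulKn.
Qed.

Lemma big_divisors (V : nmodType) (h : nat -> V) (n x : nat) : (0 < n <= x)%N ->
  \sum_(d <- divisors n) h d = \sum_(1 <= d < x.+1 | (d %| n)%N) h d.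
Proof.
move=> /andP[n_gt0 nx]; rewrite -[RHS]big_filter; apply/perm_big/uniq_perm.
- exact: divisors_uniq.
- by rewrite filter_uniq // iota_uniq.
move=> d; rewrite -dvdn_divisors // mem_filter mem_index_iota ltnS.
case: (boolP (d %| n)%N) => //= dn.
by rewrite (dvdn_gt0 n_gt0 dn) (leq_trans (dvdn_leq n_gt0 dn) nx).
Qed.

(** Pairs with d m <= x are grouped by their product n = d m. *)
Lemma sum_hyperbola (V : nmodType) (h : nat -> nat -> V) (x : nat) :
  \sum_(1 <= d < x.+1) \sum_(1 <= m < (x %/ d).+1) h d m =
  \sum_(1 <= n < x.+1) \sum_(d <- divisors n) h d (n %/ d)%N.
Proof.
transitivity (\sum_(1 <= d < x.+1) \sum_(1 <= n < x.+1 | (d %| n)%N) h d (n %/ d)%N).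
  by apply: eq_big_nat => d /andP[d_gt0 _]; rewrite sum_multiples.
under eq_bigr do rewrite big_mkcond.
rewrite exchange_big /=; apply: eq_big_nat => n /andP[n_gt0 nx].
by rewrite -big_mkcond (@big_divisors _ _ n x) ?n_gt0.
Qed.

Lemma exchange_divisors (V : nmodType) (h : nat -> nat -> V) (n : nat) : (0 < n)%N ->
  \sum_(d <- divisors n) \sum_(e <- divisors (n %/ d)) h d e =
  \sum_(e <- divisors n) \sum_(d <- divisors (n %/ e)) h d e.
Proof.
move=> n_gt0.
have key (g : nat -> nat -> V) :
  \sum_(d <- divisors n) \sum_(e <- divisors (n %/ d)) g d e =
  \sum_(d <- divisors n) \sum_(e <- divisors n) (if (d * e %| n)%N then g d e else 0).
  apply: eq_big_seq => d; rewrite -dvdn_divisors // => dn.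
  rewrite -big_mkcond -[RHS]big_filter; apply/perm_big/uniq_perm.
  - exact: divisors_uniq.
  - by rewrite filter_uniq // divisors_uniq.
  move=> e; have d_gt0 := dvdn_gt0 n_gt0 dn.
  have nd_gt0 : (0 < n %/ d)%N by rewrite divn_gt0 // dvdn_leq.
  rewrite mem_filter -!dvdn_divisors // -[in RHS](divnK dn) mulnC.
  rewrite dvdn_pmul2r //; case: (boolP (e %| n %/ d)%N) => //= h'.
  by rewrite dvdn_mulr.
rewrite key (key (fun e d => h d e)) exchange_big /=.
by apply: eq_bigr => e _; apply: eq_bigr => d _; rewrite mulnC.
Qed.

Definition von_mangoldt (n : nat) : R := if primes n is [:: p] then ln p%:R else 0.

Lemma mangoldt_ge0 n : 0 <= von_mangoldt n.
Proof.
rewrite /von_mangoldt; case E: (primes n) => [|p [|]] //; apply: ln_ge0.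
have : p \in primes n by rewrite E inE.
by rewrite mem_primes => /andP[/prime_gt0]; rewrite ler1n.
Qed.

Lemma primes_eq1P n p : primes n = [:: p] ->
  [/\ prime p, (0 < logn p n)%N & n = (p ^ logn p n)%N].
Proof.
move=> E; have pn : p \in primes n by rewrite E inE.
have /and3P[pp n0 _] : [&& prime p, (0 < n)%N & (p %| n)%N] by rewrite -mem_primes.
split; [by []|by rewrite logn_gt0|].
by rewrite {1}(prod_prime_decomp n0) prime_decompE E big_seq1.
Qed.

Lemma mangoldt_neq0 n : von_mangoldt n != 0 ->
  exists p k : nat, [/\ prime p, (0 < k)%N & n = (p ^ k)%N].
Proof.
rewrite /von_mangoldt; case E: (primes n) => [|p [|]]; rewrite ?eqxx // => _.
by have [pp k0 e] := primes_eq1P E; exists p, (logn p n).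
Qed.

Lemma mangoldt_pexp p k : prime p -> (0 < k)%N -> von_mangoldt (p ^ k) = ln p%:R.
Proof. by move=> pp k0; rewrite /von_mangoldt primesX // primes_prime. Qed.

(** Induction from m = n / p to n, with p the least prime factor: the only prime power dividing n
    but not m is p^(logn p m + 1), which contributes ln p. *)
Lemma sum_mangoldt n : (0 < n)%N -> \sum_(d <- divisors n) von_mangoldt d = ln n%:R.
Proof.
elim/ltn_ind: n => n IH n_gt0; case: (ltngtP n 1) => [|n_gt1|->]; first by lia.
  pose p := pdiv n; have pp : prime p := pdiv_prime n_gt1.
  have pn : (p %| n)%N := pdiv_dvd n.
  pose m := (n %/ p)%N; have nE : n = (m * p)%N by rewrite divnK.
  have m_gt0 : (0 < m)%N by rewrite divn_gt0 ?(prime_gt0 pp) // (dvdn_leq n_gt0 pn).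
  have mn : (m < n)%N by rewrite nE -[X in (X < _)%N]muln1 ltn_pmul2l // prime_gt1.
  rewrite (@big_divisors _ _ n n) ?n_gt0 ?leqnn //.
  rewrite (bigID (fun d => d %| m)%N) /=.
  have -> : \sum_(1 <= d < n.+1 | (d %| n)%N && (d %| m)%N) von_mangoldt d = ln m%:R.
    rewrite -IH // (@big_divisors _ _ m n) ?m_gt0 1?ltnW //.
    apply: eq_bigl => d; case: (boolP (d %| m)%N) => dm; rewrite ?andbF ?andbT //.
    by rewrite nE dvdn_mulr.
  pose e := (logn p m).+1.
  have pe_n : (p ^ e %| n)%N by rewrite nE expnSr dvdn_mul ?pfactor_dvdnn.
  have pe_m : ~~ (p ^ e %| m)%N by rewrite pfactor_dvdn // ltnn.
  rewrite big_mkcond (bigD1_seq (p ^ e)%N) ?iota_uniq //=; last first.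
    by rewrite mem_index_iota expn_gt0 prime_gt0 //= ltnS dvdn_leq.
  rewrite pe_n pe_m mangoldt_pexp // big1 ?addr0 => [|d dpe].
    by rewrite [in RHS]nE natrM lnM // posrE ltr0n // prime_gt0.
  case: ifP => // /andP[dn dm]; apply/eqP; apply: contraNT dpe.
  case/mangoldt_neq0 => r [k [rp k0 dE]]; move: dn dm; rewrite dE nE => dn dm.
  have [rp'|rp'] := eqVneq r p; last first.
    move: dm; rewrite -(Gauss_dvdl _ (_ : coprime (r ^ k) p)) ?dn //.
    by rewrite coprimeXl // prime_coprime // dvdn_prime2.
  rewrite rp' in dn dm *; move: dn dm; rewrite !pfactor_dvdn ?muln_gt0 ?m_gt0 ?prime_gt0 //.
  rewrite (lognM _ m_gt0 (prime_gt0 pp)). rewrite (logn_prime p pp) eqxx -ltnNge => h1 h2.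
  by rewrite eqn_exp2l ?prime_gt1 // /e; lia.
by rewrite big_seq1 /von_mangoldt /= ln1.
Qed.
End Arithmetic.

(** * Mobius inversion and the Tatuzawa-Iseki identity *)

Section Mobius.
Variable R : realType.

Definition mobius (n : nat) : R :=
  if all (fun p => logn p n == 1%N) (primes n) then (-1) ^+ size (primes n) else 0.

Lemma mobius_norm_le1 n : `|mobius n| <= 1.
Proof. by rewrite /mobius; case: ifP => _; rewrite ?normr0 // normrX normrN1 expr1n. Qed.

Lemma mobius_mul_prime (p d : nat) : prime p -> (0 < d)%N ->
  mobius (p * d) = if (p %| d)%N then 0 else - mobius d.
Proof.
move=> pp d0; have p0 := prime_gt0 pp; have pd0 : (0 < p * d)%N by rewrite muln_gt0 p0.
have lp r : logn r (p * d) = ((r == p) + logn r d)%N by rewrite lognM // logn_prime.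
have pin : p \in primes (p * d) by rewrite mem_primes pp pd0 dvdn_mulr.
case: ifP => pd.
  rewrite /mobius (_ : all _ _ = false) //; apply/negP => /allP /(_ p pin).
  by rewrite lp eqxx add1n eqSS -leqn0 leqNgt logn_gt0 mem_primes pp d0 pd.
have pnot : p \notin primes d by rewrite mem_primes pp d0 pd.
have peq : perm_eq (primes (p * d)) (p :: primes d).
  apply: uniq_perm; rewrite /= ?primes_uniq ?pnot // => r.
  by rewrite primesM // inE primes_prime // inE.
rewrite /mobius (perm_size peq) (perm_all _ peq) /= lp eqxx.
rewrite (_ : logn p d = 0%N) /=; last first.
  by apply/eqP; rewrite -leqn0 leqNgt logn_gt0.
rewrite (_ : all _ (primes d) = all (fun r => logn r d == 1%N) (primes d)).
  by case: ifP => _; rewrite ?oppr0 // exprS mulN1r.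
apply: eq_in_all => r rd; rewrite lp; have [rp|//] := eqVneq r p.
by rewrite -rp rd in pnot.
Qed.

(** With p the least prime factor of n > 1, a divisor p c with c prime to p cancels the divisor c;
    divisors with p^2 contribute nothing. *)
Lemma sum_mobius n : (0 < n)%N -> \sum_(d <- divisors n) mobius d = (n == 1%N)%:R.
Proof.
move=> n_gt0; case: (ltngtP n 1) => [|n_gt1|->]; first by lia.
  pose p := pdiv n; have pp : prime p := pdiv_prime n_gt1.
  have pn : (p %| n)%N := pdiv_dvd n; have p0 := prime_gt0 pp.
  rewrite (@big_divisors _ _ n n) ?n_gt0 ?leqnn // (bigID (fun d => p %| d)%N) /=.
  have -> : \sum_(1 <= d < n.+1 | (d %| n)%N && (p %| d)%N) mobius d =
    \sum_(1 <= d < n.+1 | (p %| d)%N) (fun c => if (c %| n %/ p)%N then mobius (p * c) else 0) (d %/ p)%N.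
    rewrite big_mkcondl; apply: eq_bigr => d pd /=.
    rewrite [(p * _)%N]mulnC. rewrite divnK // (_ : (d %| n)%N = (d %/ p %| n %/ p)%N) //.
    by rewrite -[in RHS](dvdn_pmul2r p0) !divnK.
  rewrite (sum_multiples (fun c => if (c %| n %/ p)%N then mobius (p * c) else 0)) //.
  have -> : \sum_(1 <= m < (n %/ p).+1) (if (m %| n %/ p)%N then mobius (p * m) else 0) =
    \sum_(1 <= m < (n %/ p).+1) (if (m %| n)%N && ~~ (p %| m)%N then - mobius m else 0).
    apply: eq_big_nat => m /andP[m0 _]; rewrite mobius_mul_prime //.
    case: (boolP (p %| m)%N) => pm; rewrite ?andbF ?if_same // andbT.
    congr (if _ then _ else _); rewrite -[in RHS](divnK pn) Gauss_dvdl //.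
    by rewrite coprime_sym prime_coprime.
  rewrite -big_mkcond /= sumrN.
  (* The pairing only reaches c <= n / p, but a divisor of n prime to p divides n / p, so nothing
     remains beyond. *)
  rewrite [X in _ + X](@big_cat_nat _ _ _ (n %/ p).+1) /= ?ltnS ?leq_div //.
  rewrite addrA addNr add0r big_nat_cond big1 // => d /andP[/andP[h1 h2] /andP[dn pd]].
  have : (d %| n %/ p)%N.
    by rewrite -(Gauss_dvdl _ (_ : coprime d p)) ?divnK // coprime_sym prime_coprime.
  move/dvdn_leq; rewrite divn_gt0 // (dvdn_leq n_gt0 pn) => /(_ isT); lia.
by rewrite big_seq1 /mobius /= expr0.
Qed.

(** Mobius inversion of [sum_mangoldt]. *)
Lemma mobius_conv_ln n : (0 < n)%N ->
  \sum_(d <- divisors n) mobius d * ln (n %/ d)%:R = von_mangoldt R n.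
Proof.
move=> n0.
transitivity (\sum_(d <- divisors n) \sum_(e <- divisors (n %/ d)) mobius d * von_mangoldt R e).
  apply: eq_big_seq => d; rewrite -dvdn_divisors // => dn.
  rewrite -big_distrr /= sum_mangoldt // divn_gt0 ?(dvdn_gt0 n0 dn) //.
  exact: dvdn_leq.
rewrite exchange_divisors //.
transitivity (\sum_(e <- divisors n) (if e == n then von_mangoldt R e else 0)).
  apply: eq_big_seq => e; rewrite -dvdn_divisors // => en.
  have e0 := dvdn_gt0 n0 en.
  rewrite -big_distrl /= sum_mobius ?divn_gt0 ?(dvdn_leq n0) //.
  rewrite (_ : (n %/ e == 1)%N = (e == n)); first by case: eqP => _; rewrite ?mul1r ?mul0r.
  apply/eqP/eqP => [h|->]; last by rewrite divnn n0.
  by rewrite -[RHS](divnK en) h mul1n.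
rewrite (bigD1_seq n) ?divisors_uniq //=; last by rewrite -dvdn_divisors.
by rewrite eqxx big1 ?addr0 // => e /negPf ->.
Qed.

Lemma mobius_conv_ln_quotient (x n : nat) : (0 < n)%N -> (0 < x)%N ->
  \sum_(d <- divisors n) mobius d * ln (x%:R / d%:R) = (n == 1%N)%:R * ln x%:R + von_mangoldt R n.
Proof.
move=> n0 x0.
transitivity (\sum_(d <- divisors n)
   (mobius d * (ln x%:R - ln n%:R) + mobius d * ln (n %/ d)%:R)); last first.
  rewrite big_split /= mobius_conv_ln // -big_distrl /= sum_mobius //.
  by case: eqP => [->|_]; rewrite ?ln1 ?subr0 ?mul0r.
apply: eq_big_seq => d; rewrite -dvdn_divisors // => dn; rewrite -mulrDr.
have d0 := dvdn_gt0 n0 dn.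
have nd0 : (0 < n %/ d)%N by rewrite divn_gt0 // dvdn_leq.
have -> : ln n%:R = ln (n %/ d)%:R + ln d%:R :> R.
  by rewrite -lnM ?posrE ?ltr0n // -natrM divnK.
by rewrite ln_div ?posrE ?ltr0n //; congr (_ * _); ring.
Qed.

(** Collecting the terms with d m = n, F n receives the sum over d | n of mu(d) ln(x / d), which is
    Lambda(n), plus ln x when n = 1. *)
Lemma tatuzawa_iseki (F : nat -> R) (x : nat) : (0 < x)%N ->
  \sum_(1 <= d < x.+1) mobius d * (ln (x%:R / d%:R) * \sum_(1 <= m < (x %/ d).+1) F (d * m)%N) =
  F 1%N * ln x%:R + \sum_(1 <= n < x.+1) von_mangoldt R n * F n.
Proof.
move=> x0.
under eq_bigr do rewrite mulrA big_distrr /=.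
rewrite (sum_hyperbola (fun d m => mobius d * ln (x%:R / d%:R) * F (d * m)%N)).
transitivity (\sum_(1 <= n < x.+1) F n * ((n == 1%N)%:R * ln x%:R + von_mangoldt R n)).
  apply: eq_big_nat => n /andP[n0 _].
  rewrite -mobius_conv_ln_quotient // big_distrr /=; apply: eq_big_seq => d.
  by rewrite -dvdn_divisors // => dn; rewrite [(d * _)%N]mulnC divnK // mulrC.
under eq_bigr do rewrite mulrDr [F _ * von_mangoldt _ _]mulrC.
rewrite big_split /=; congr (_ + _).
rewrite big_ltn // eqxx mul1r big_nat_cond big1 ?addr0 // => n /andP[/andP[n1 _] _].
by rewrite gtn_eqF // mul0r mulr0.
Qed.
End Mobius.

(** * Stirling bounds and the Chebyshev function *)

Section FactorialSums.
Variable R : realType.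

Lemma sum_hyperbola_sym (V : nmodType) (h : nat -> nat -> V) (x : nat) :
  \sum_(1 <= d < x.+1) \sum_(1 <= m < (x %/ d).+1) h d m =
  \sum_(1 <= m < x.+1) \sum_(1 <= d < (x %/ m).+1) h d m.
Proof.
have key (g : nat -> nat -> V) :
  \sum_(1 <= d < x.+1) \sum_(1 <= m < (x %/ d).+1) g d m =
  \sum_(1 <= d < x.+1) \sum_(1 <= m < x.+1) (if (d * m <= x)%N then g d m else 0).
  apply: eq_big_nat => d /andP[d0 _].
  rewrite -big_mkcond [RHS](@big_cat_nat _ _ _ (x %/ d).+1) /= ?ltnS ?leq_div //.
  rewrite [X in _ + X]big_nat_cond [X in _ + X]big1 ?addr0; last first.
    by move=> m /andP[/andP[h1 _]]; rewrite mulnC -leq_divRL // leqNgt h1.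
  rewrite big_nat_cond [RHS]big_nat_cond; apply: eq_bigl => m.
  by rewrite ltnS leq_divRL // mulnC; case: (_ <= x)%N; rewrite ?andbT ?andbF.
rewrite key (key (fun m d => h d m)) exchange_big /=.
by apply: eq_bigr => m _; apply: eq_bigr => d _; rewrite mulnC.
Qed.

Lemma ln_le_sub1 (x : R) : 0 < x -> ln x <= x - 1.
Proof. by move=> x0; have := @le_ln1Dx R (x - 1); rewrite addrCA subrr addr0; apply; lra. Qed.

Lemma ln_le_div (x a : R) : 0 < x -> 0 < a -> ln x <= x / a - 1 + ln a.
Proof.
move=> x0 a0; have := ln_le_sub1 (divr_gt0 x0 a0).
by rewrite ln_div ?posrE //; lra.
Qed.

Lemma ln_natS_sub (n : nat) : (0 < n)%N ->
  n.+1%:R^-1 <= ln n.+1%:R - ln n%:R :> R /\ ln n.+1%:R - ln n%:R <= n%:R^-1 :> R.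
Proof.
move=> n0; have n0' : 0 < n%:R :> R by rewrite ltr0n.
have s0 : 0 < n.+1%:R :> R by rewrite ltr0n.
have e : n.+1%:R = n%:R + 1 :> R by rewrite -natr1.
split.
  have := ln_le_sub1 (divr_gt0 n0' s0); rewrite ln_div ?posrE //.
  have -> : n%:R / n.+1%:R - 1 = - n.+1%:R^-1 :> R by rewrite e; field; lra.
  by move: (ln _) (ln _) (_^-1) => *; lra.
have := ln_le_sub1 (divr_gt0 s0 n0'); rewrite ln_div ?posrE //.
have -> : n.+1%:R / n%:R - 1 = n%:R^-1 :> R by rewrite e; field; lra.
by move: (ln _) (ln _) (_^-1) => *; lra.
Qed.

Lemma ln_fact_ge (n : nat) : (0 < n)%N -> n%:R * ln n%:R - n%:R <= ln n`!%:R :> R.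
Proof.
elim: n => // -[_ _|n IH _]; first by rewrite ln1; lra.
have n0 : (0 < n.+1)%N by []. have [_ h] := ln_natS_sub n0.
have n0' : 0 < n.+1%:R :> R by rewrite ltr0n.
rewrite factS natrM lnM ?posrE ?ltr0n ?fact_gt0 //.
have := IH isT; have e : n.+2%:R = n.+1%:R + 1 :> R by rewrite -natr1.
have : n.+1%:R * (ln n.+2%:R - ln n.+1%:R) <= 1 :> R.
  by rewrite mulrC -ler_pdivlMr // div1r.
move: (ln (n.+2%:R : R)) (ln (n.+1%:R : R)) (ln _) => x y z.
rewrite e; move: (n.+1%:R : R) => w.
by move=> *; nra.
Qed.

Lemma ln_fact_le (n : nat) : (0 < n)%N ->
  ln n`!%:R <= n%:R * ln n%:R - n%:R + ln n%:R + 1 :> R.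
Proof.
elim: n => // -[_ _|n IH _]; first by rewrite ln1; lra.
have n0 : (0 < n.+1)%N by []. have [h _] := ln_natS_sub n0.
have n0' : 0 < n.+2%:R :> R by rewrite ltr0n.
rewrite factS natrM lnM ?posrE ?ltr0n ?fact_gt0 //.
have := IH isT; have e : n.+2%:R = n.+1%:R + 1 :> R by rewrite -natr1.
have : 1 <= (ln n.+2%:R - ln n.+1%:R) * n.+2%:R :> R.
  by rewrite -ler_pdivrMr // div1r.
move: (ln (n.+2%:R : R)) (ln (n.+1%:R : R)) (ln _) => x y z.
rewrite e; move: (n.+1%:R : R) => w.
by move=> *; nra.
Qed.

Lemma ln_fact_sum (n : nat) : ln n`!%:R = \sum_(1 <= k < n.+1) ln k%:R :> R.
Proof.
elim: n => [|n IH]; first by rewrite big_nil fact0 ln1.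
by rewrite big_nat_recr //= -IH factS mulnC natrM lnM // posrE ltr0n ?fact_gt0.
Qed.

Definition chebyshev_psi (n : nat) : R := \sum_(1 <= d < n.+1) von_mangoldt R d.

Local Notation psi := chebyshev_psi.

Lemma psi0 : psi 0 = 0. Proof. by rewrite /chebyshev_psi big_nil. Qed.

Lemma psi_trunc (m n : nat) : (m <= n)%N ->
  psi m = \sum_(1 <= d < n.+1) (d <= m)%N%:R * von_mangoldt R d.
Proof.
move=> mn; rewrite (@big_cat_nat _ _ _ m.+1) //= [X in _ + X]big_nat_cond [X in _ + X]big1.
  rewrite addr0 /chebyshev_psi; apply: eq_big_nat => d /andP[_]; rewrite ltnS => ->.
  by rewrite mul1r.
by move=> d /andP[/andP[h _] _]; rewrite leqNgt h mul0r.
Qed.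

Lemma psi_sub (m n : nat) : (m <= n)%N -> psi n - psi m = \sum_(m.+1 <= d < n.+1) von_mangoldt R d.
Proof. by move=> mn; rewrite /chebyshev_psi (@big_cat_nat _ _ _ m.+1) //= addrAC subrr add0r. Qed.

Lemma psi_le (m n : nat) : (m <= n)%N -> psi m <= psi n.
Proof.
move=> mn; rewrite -subr_ge0 psi_sub //; apply: sumr_ge0 => d _; exact: mangoldt_ge0.
Qed.

Lemma psi_ge0 n : 0 <= psi n. Proof. by rewrite -psi0 psi_le. Qed.

Lemma sum_mangoldt_floor (n : nat) :
  \sum_(1 <= d < n.+1) von_mangoldt R d * (n %/ d)%:R = ln n`!%:R.
Proof.
rewrite ln_fact_sum.
transitivity (\sum_(1 <= d < n.+1) \sum_(1 <= m < (n %/ d).+1) von_mangoldt R d).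
  by apply: eq_bigr => d _; rewrite sumr_const_nat subSS subn0 mulr_natr.
by rewrite sum_hyperbola; apply: eq_big_nat => k /andP[k0 _]; rewrite sum_mangoldt.
Qed.

Lemma sum_psi_div (n : nat) : \sum_(1 <= m < n.+1) psi (n %/ m) = ln n`!%:R.
Proof.
rewrite -sum_mangoldt_floor.
transitivity (\sum_(1 <= d < n.+1) \sum_(1 <= m < (n %/ d).+1) von_mangoldt R d).
  by rewrite sum_hyperbola_sym.
by apply: eq_bigr => d _; rewrite sumr_const_nat subSS subn0 mulr_natr.
Qed.

Lemma fact_half_le (n : nat) : (n`! <= 2 ^ n * (n./2`! * n./2`! * n.+1))%N.
Proof.
have hn : (n./2 <= n)%N by lia.
have b2 : ('C(n, n./2) <= 2 ^ n)%N.
  have := expnDn 1 1 n; rewrite addn1 => ->.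
  rewrite (bigD1 (inord n./2 : 'I_n.+1)) //= inordK ?ltnS // !exp1n !muln1.
  exact: leq_addr.
rewrite -(bin_fact hn); apply: leq_mul => //.
rewrite -mulnA leq_mul2l; apply/orP; right.
have -> : (n - n./2 = n./2 + odd n)%N by have := odd_double_half n; lia.
case: (odd n); rewrite ?addn0 ?addn1 ?factS; last by rewrite leq_pmulr.
by rewrite mulnC leq_mul2l; apply/orP; right; lia.
Qed.

Lemma ln2_le : ln 2 <= 5 / 6 :> R.
Proof.
have -> : 2 = (3 / 2) * (4 / 3) :> R by field.
rewrite lnM ?posrE; try lra.
have := @ln_le_sub1 (3 / 2); have := @ln_le_sub1 (4 / 3); lra.
Qed.

(** With h = n./2, the logarithm of n! / h!^2 weighs Lambda(d) by floor(n / d) - 2 floor(h / d),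
    which is nonnegative and at least 1 for h < d <= n. The quotient is at most 2^n (n + 1), and 5/6
    bounds ln 2. *)
Lemma psi_sub_half (n : nat) : psi n - psi n./2 <= n%:R * (5 / 6) + ln n.+1%:R.
Proof.
have hn : (n./2 <= n)%N by lia.
have h1 : psi n - psi n./2 <= ln n`!%:R - 2 * ln n./2`!%:R.
  rewrite -!sum_mangoldt_floor [X in _ - 2 * X](_ : _ =
    \sum_(1 <= d < n.+1) von_mangoldt R d * (n./2 %/ d)%:R); last first.
    rewrite [RHS](@big_cat_nat _ _ _ n./2.+1) //= [X in _ + X]big_nat_cond [X in _ + X]big1 ?addr0 //.
    by move=> d /andP[/andP[h _] _]; rewrite divn_small // mulr0.
  rewrite (psi_trunc hn) {1}/chebyshev_psi big_distrr /= -!sumrB.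
  apply: ler_sum_nat => d /andP[d0 dn].
  have -> : von_mangoldt R d - (d <= n./2)%N%:R * von_mangoldt R d = von_mangoldt R d * (1 - (d <= n./2)%N%:R) by ring.
  have -> : von_mangoldt R d * (n %/ d)%:R - 2 * (von_mangoldt R d * (n./2 %/ d)%:R) =
            von_mangoldt R d * ((n %/ d)%:R - 2 * (n./2 %/ d)%:R) by ring.
  apply: ler_wpM2l; first exact: mangoldt_ge0.
  have : ((n./2 < d) + 2 * (n./2 %/ d) <= n %/ d)%N.
    have [hd|dh] := ltnP n./2 d; first by rewrite divn_small // muln0 addn0 divn_gt0.
    rewrite add0n leq_divRL // -mulnA.
    by move: (leq_divM n./2 d); move: (_ * d)%N => k; lia.
  rewrite -(ler_nat R) natrD natrM; case: ltnP => _ /=; first by lra.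
  by rewrite add0r subrr subr_ge0.
apply: (le_trans h1).
have : ln n`!%:R <= ln (2 ^ n * (n./2`! * n./2`! * n.+1))%N%:R :> R.
  by rewrite ler_ln ?posrE ?ler_nat ?ltr0n ?fact_half_le ?fact_gt0 ?muln_gt0 ?expn_gt0 ?fact_gt0.
rewrite !natrM natrX !lnM ?posrE ?mulr_gt0 ?exprn_gt0 ?ltr0n ?fact_gt0 //.
rewrite lnXn // -[ln 2 *+ n]mulr_natr; have := ln2_le; have : 0 <= n%:R :> R by [].
move: (ln _) (ln _) (ln _) (ln _) => a b c e; move: (n%:R : R) => w; nra.
Qed.
End FactorialSums.

(** * Chebyshev and Mertens bounds, Euler's constant *)

Section ChebyshevMertens.
Variable R : realType.
Local Notation psi := (chebyshev_psi R).

Lemma nat_above (x : R) : exists n : nat, x <= n%:R.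
Proof.
by exists (Num.truncn x).+1; exact/ltW/truncnS_gt.
Qed.

Lemma psi_le_linear : exists2 C : R, 0 <= C & forall n, psi n <= 7 / 4 * n%:R + C.
Proof.
(* One halving uses 5/6 + 7/8 = 41/24 of the slope 7/4; the spare n / 24 absorbs ln(n + 1) beyond
   this threshold. *)
have [n0 hn0] := nat_above (1 + 48 * ln 48).
exists (psi n0) => [|n]; first exact: psi_ge0.
elim/ltn_ind: n => n IH.
have [nn0|nn0] := leqP n n0.
  by apply: (le_trans (psi_le R nn0)); rewrite lerDr mulr_ge0 //; lra.
have hn : n0%:R <= n%:R :> R by rewrite ler_nat ltnW.
have h1 := psi_sub_half R n.
have h2 : psi n./2 <= 7 / 4 * n./2%:R + psi n0 by apply: IH; lia.
have h3 : 2 * n./2%:R <= n%:R :> R by rewrite -natrM ler_nat; lia.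
have h4 : ln n.+1%:R <= n.+1%:R / 48 - 1 + ln 48 :> R by apply: ln_le_div; rewrite ?ltr0n.
have e : n.+1%:R = n%:R + 1 :> R by rewrite -natr1.
move: h4; rewrite {2}e => h4.
move: hn0 hn h1 h2 h3 h4; move: (ln _) (ln _) (psi _) (psi _) (psi _) => a b c f g.
move: (n%:R : R) (n0%:R : R) (n./2%:R : R) => x y z; clear; lra.
Qed.

Lemma chebyshev : exists2 A : R, 0 <= A & forall n, psi n <= A * n%:R.
Proof.
have [C C0 h] := psi_le_linear; exists (7 / 4 + C) => [|n]; first by lra.
case: n => [|n]; first by rewrite psi0 mulr0.
apply: (le_trans (h _)); have : 1 <= n.+1%:R :> R by rewrite ler1n.
by move: (n.+1%:R : R) => x; nra.
Qed.

Lemma floor_div_le (n d : nat) : (0 < d)%N -> (n %/ d)%:R <= n%:R / d%:R :> R.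
Proof. by move=> d0; rewrite ler_pdivlMr ?ltr0n // -natrM ler_nat leq_divM. Qed.

Lemma floor_div_gt (n d : nat) : (0 < d)%N -> n%:R / d%:R < (n %/ d)%:R + 1 :> R.
Proof.
by move=> d0; rewrite ltr_pdivrMr ?ltr0n // natr1 -natrM ltr_nat ltn_ceil.
Qed.

Definition mangoldt_log_sum (n : nat) : R := \sum_(1 <= d < n.+1) von_mangoldt R d / d%:R.

(** Dropping the floors in [sum_mangoldt_floor] costs at most psi n = O(n), and Stirling gives ln n!
    = n ln n + O(n). *)
Lemma mertens : exists2 A : R, 0 <= A &
  forall n, (0 < n)%N -> `|mangoldt_log_sum n - ln n%:R| <= A.
Proof.
have [A A0 hA] := chebyshev; exists (A + 1) => [|n n0]; first by lra.
have n0' : 0 < n%:R :> R by rewrite ltr0n.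
have f1 := ln_fact_ge R n0; have f2 := ln_fact_le R n0.
have l1 : ln n%:R <= n%:R - 1 :> R by exact: ln_le_sub1.
have h1 : ln n`!%:R <= n%:R * mangoldt_log_sum n.
  rewrite -sum_mangoldt_floor big_distrr /=; apply: ler_sum_nat => d /andP[d0 _].
  by rewrite mulrCA ler_wpM2l ?mangoldt_ge0 ?floor_div_le.
have h2 : n%:R * mangoldt_log_sum n - psi n <= ln n`!%:R.
  rewrite -sum_mangoldt_floor big_distrr /= -sumrB; apply: ler_sum_nat => d /andP[d0 _].
  rewrite mulrCA -[X in _ - X]mulr1 -mulrBr ler_wpM2l ?mangoldt_ge0 //.
  by rewrite lerBlDr; exact/ltW/floor_div_gt.
have := hA n; move: (psi n) (mangoldt_log_sum n) (ln (n%:R : R)) (ln _) n0' f1 f2 l1 h1 h2.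
move: (n%:R : R) => x p m l f x0 f1 f2 l1 h1 h2 h3; rewrite ler_norml.
by rewrite -(ler_pM2l x0) -[X in _ && X](ler_pM2l x0); apply/andP; split; nra.
Qed.

Definition harmonic_sum (n : nat) : R := \sum_(1 <= k < n.+1) k%:R^-1.

(** The constant is the supremum of the increasing sequence [a], bounded above by the decreasing
    [b]; at the same harmonic sum the two differ by ln(1 + 1/n). *)
Lemma euler_gamma : exists g : R,
  forall n, (0 < n)%N -> `|harmonic_sum n - ln n%:R - g| <= n%:R^-1.
Proof.
pose a n : R := harmonic_sum n - ln n.+1%:R.
pose b n : R := harmonic_sum n.+1 - ln n.+1%:R.
have hS n : harmonic_sum n.+1 = harmonic_sum n + n.+1%:R^-1.
  by rewrite /harmonic_sum big_nat_recr.
have a_mono : {homo a : m n / (m <= n)%N >-> m <= n}.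
  apply: homo_leq => [x|x y z h1 h2|n]; [exact: lexx|exact: le_trans h1 h2|].
  by rewrite /a hS; have [_] := @ln_natS_sub R n.+1 isT; move: (ln _) (ln _) (_^-1) => *; lra.
have b_mono : {homo b : m n / (m <= n)%N >-> n <= m}.
  apply: (@homo_leq _ b (fun x y => y <= x)) => [x|x y z h1 h2|n]; [exact: lexx|exact: le_trans h2 h1|].
  by rewrite /b [harmonic_sum n.+2]hS; have [+ _] := @ln_natS_sub R n.+1 isT; move: (ln _) (ln _) (_^-1) => *; lra.
have ab n : a n <= b n by rewrite /a /b hS lerD2r lerDl invr_ge0.
have ab' m n : a m <= b n.
  apply: (le_trans (a_mono _ _ (leq_maxl m n))); apply: (le_trans (ab _)).
  by apply: b_mono; exact: leq_maxr.
exists (sup (range a)) => -[//|n] _.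
have hub : ubound (range a) (b n) by move=> _ [m _ <-].
have h1 : sup (range a) <= b n by apply: ge_sup => //; exists (a 0%N), 0%N.
have h2 : a n.+1 <= sup (range a) by apply: ub_le_sup; [exists (b n)|exists n.+1].
have [_] := @ln_natS_sub R n.+1 isT; move: h1 h2; rewrite /a /b.
move: (sup _) (ln _) (ln _) (_^-1) (harmonic_sum _) => *.
by rewrite ler_norml; apply/andP; split; lra.
Qed.

End ChebyshevMertens.

(** * Selberg's formula *)

Section Selberg.
Variable R : realType.
Local Notation psi := (chebyshev_psi R).
Local Notation mangoldt := (von_mangoldt R).

Lemma sum_inv_sqrt_le (n : nat) :
  \sum_(1 <= d < n.+1) (Num.sqrt d%:R)^-1 <= 2 * Num.sqrt n%:R :> R.
Proof.
elim: n => [|n IH]; first by rewrite big_nil sqrtr0 mulr0.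
rewrite big_nat_recr //=; apply: (le_trans (lerD IH (lexx _))).
have s0 : 0 < Num.sqrt n.+1%:R :> R by rewrite sqrtr_gt0 ltr0n.
have t0 : 0 <= Num.sqrt n%:R :> R by exact: sqrtr_ge0.
have s2 : Num.sqrt n.+1%:R ^+ 2 = n%:R + 1 :> R by rewrite sqr_sqrtr ?ler0n // -natr1.
have t2 : Num.sqrt n%:R ^+ 2 = n%:R :> R by rewrite sqr_sqrtr ?ler0n.
move: (Num.sqrt _) (Num.sqrt _) s0 t0 s2 t2 => t s s0 t0 s2 t2.
have : t ^+ 2 <= s ^+ 2 by rewrite s2 t2; lra.
rewrite ler_sqr ?nnegrE //; last exact: ltW.
move=> ts.
have h : s^-1 <= 2 * (s - t) by rewrite -div1r ler_pdivrMr //; nra.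
by lra.
Qed.

(** With r the fourth root of y, ln y = 4 ln r <= 4 (r - 1). *)
Lemma sqr_ln_le_sqrt (y : R) : 1 <= y -> (1 + ln y) ^+ 2 <= 16 * Num.sqrt y.
Proof.
move=> y1; have y0 : 0 < y by lra.
pose r := Num.sqrt (Num.sqrt y).
have r0 : 0 < r by rewrite !sqrtr_gt0.
have r2 : r ^+ 2 = Num.sqrt y by rewrite sqr_sqrtr ?sqrtr_ge0.
have r4 : r ^+ 4 = y by rewrite (exprM r 2 2) r2 sqr_sqrtr // ltW.
have l0 : 0 <= ln y by exact: ln_ge0.
have h : ln y <= 4 * (r - 1).
  rewrite -r4 lnXn // -[ln r *+ 4]mulr_natl; apply: ler_wpM2l => //.
  exact: ln_le_sub1.
rewrite -r2; have -> : 16 * r ^+ 2 = (4 * r) ^+ 2 by ring.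
by rewrite ler_sqr ?nnegrE; lra.
Qed.

(** In [tatuzawa_iseki] for [F], the inner sums [S d] are O(1 + ln(x / d)), so the Mobius side is
    O(x), being a sum of terms O(sqrt(x / d)). The other side becomes Selberg's expression through
    Mertens. *)
Theorem selberg_formula : exists2 A : R, 0 <= A & forall x, (0 < x)%N ->
  `|psi x * ln x%:R + \sum_(1 <= n < x.+1) mangoldt n * psi (x %/ n) - 2 * x%:R * ln x%:R|
  <= A * x%:R.
Proof.
have [g hg] := euler_gamma R.
have [C C0 hC] := chebyshev R.
have [M M0 hM] := mertens R.
pose K := 3 + `|g|; have K0 : 0 <= K by rewrite /K; have := normr_ge0 g; lra.
exists (32 * K + M + `|g + 1| * (1 + C)) => [|x x0].
  by have := normr_ge0 (g + 1); nra.
have x0' : 0 < x%:R :> R by rewrite ltr0n.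
(* With y = x / d and N its floor, [g + 1] makes N ln N - N - y (ln N + g) + (g + 1) N collapse to
   (N - y) (ln N + g). *)
pose F n : R := psi (x %/ n) - x%:R / n%:R + (g + 1).
pose S d : R := \sum_(1 <= m < (x %/ d).+1) F (d * m)%N.
have SE d : (0 < d)%N -> S d = ln (x %/ d)`!%:R - x%:R / d%:R * harmonic_sum R (x %/ d)
    + (g + 1) * (x %/ d)%:R.
  move=> d0; rewrite /S /F big_split big_split /= -sum_psi_div sumr_const_nat subSS subn0 mulr_natr.
  congr (_ + _ + _); first by apply: eq_bigr => m _; rewrite divnMA.
  rewrite sumrN /harmonic_sum big_distrr /=; congr (- _).
  by apply: eq_bigr => m _; rewrite natrM invfM mulrA.
have SB : forall d : nat, (0 < d <= x)%N -> `|ln (x%:R / d%:R) * S d| <= 16 * K * Num.sqrt (x%:R / d%:R).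
  move=> d /andP[d0 dx]; rewrite SE //; set y := x%:R / d%:R; set N := (x %/ d)%N.
  have N0 : (0 < N)%N by rewrite divn_gt0.
  have N1 : 1 <= N%:R :> R by rewrite ler1n.
  have Ny : N%:R <= y by exact: floor_div_le.
  have yN : y < N%:R + 1 by exact: floor_div_gt.
  have f1 := ln_fact_ge R N0; have f2 := ln_fact_le R N0.
  have l0 : 0 <= ln N%:R :> R by apply: ln_ge0.
  have ly : ln N%:R <= ln y by rewrite ler_ln ?posrE //; lra.
  have y1 : 1 <= y by lra.
  have := sqr_ln_le_sqrt y1; have := hg N N0.
  move: f1 f2 l0 ly N1 Ny yN y1; clearbody y; rewrite normrM.
  move: (ln N`!%:R) (harmonic_sum R N) (N%:R : R) (ln (N%:R : R)) (ln y) (Num.sqrt y).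
  move=> f h n lN l sq f1 f2 l0 ly N1 Ny yN y1 hgn hsq.
  have hy : `|y * (h - lN - g)| <= 2.
    rewrite normrM (ger0_norm (_ : 0 <= y)); last by lra.
    apply: (@le_trans _ _ (y * n^-1)); first by apply: ler_wpM2l => //; lra.
    by rewrite ler_pdivrMr; lra.
  have hgy : `|g * (y - n)| <= `|g|.
    by rewrite normrM; apply: ler_piMr => //; rewrite ger0_norm; lra.
  have hB : `|f - y * h + (g + 1) * n| <= K * (1 + l).
    have -> : f - y * h + (g + 1) * n =
      (f - n * lN + n) - (y - n) * lN - g * (y - n) - y * (h - lN - g) by ring.
    move: hy hgy; rewrite /K; move: (y * (h - lN - g)) (g * (y - n)) => u v.
    rewrite !ler_norml => /andP[u1 u2] /andP[v1 v2]; have := normr_ge0 g => g0.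
    have w1 : 0 <= (y - n) * lN by nra.
    have w2 : (y - n) * lN <= lN by nra.
    have w3 : 0 <= `|g| * l by nra.
    apply/andP; split; nra.
  rewrite ger0_norm; last by lra.
  apply: (@le_trans _ _ (K * (1 + l) ^+ 2)); last by nra.
  have := normr_ge0 (f - y * h + (g + 1) * n); nra.
have := tatuzawa_iseki F x0; rewrite -/(S _) => TI.
have E : `|F 1%N * ln x%:R + \sum_(1 <= n < x.+1) mangoldt n * F n| <= 32 * K * x%:R.
  rewrite -TI; apply: (le_trans (ler_norm_sum _ _ _)).
  apply: (@le_trans _ _ (\sum_(1 <= d < x.+1) 16 * K * Num.sqrt x%:R * (Num.sqrt d%:R)^-1)).
    apply: ler_sum_nat => d dx; rewrite normrM -[X in _ <= X]mul1r.
    apply: ler_pM => //; first exact: mobius_norm_le1.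
    apply: (le_trans (SB d dx)); rewrite sqrtrM ?ler0n // sqrtrV ?ler0n // mulrA.
    exact: lexx.
  rewrite -big_distrr /=.
  apply: (@le_trans _ _ (16 * K * Num.sqrt x%:R * (2 * Num.sqrt x%:R))).
    apply: ler_wpM2l; last exact: sum_inv_sqrt_le.
    by rewrite mulr_ge0 ?sqrtr_ge0 //; lra.
  have -> : 16 * K * Num.sqrt x%:R * (2 * Num.sqrt x%:R) = 32 * K * Num.sqrt x%:R ^+ 2 by ring.
  by rewrite sqr_sqrtr.
have sumE : \sum_(1 <= n < x.+1) mangoldt n * F n =
   \sum_(1 <= n < x.+1) mangoldt n * psi (x %/ n) - x%:R * mangoldt_log_sum R x + (g + 1) * psi x.
  rewrite /mangoldt_log_sum [in psi x]/chebyshev_psi !big_distrr /= -sumrB -big_split /=.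
  by apply: eq_bigr => n _; rewrite /F; ring.
move: E; rewrite sumE /F divn1 divr1.
have := hC x; have := psi_ge0 R x; have := hM x x0.
have : `|ln x%:R| <= x%:R :> R.
  rewrite ger0_norm ?ln_ge0 ?ler1n //; have := ln_le_sub1 x0'; lra.
have := normr_ge0 (g + 1).
move: (\sum_(_ <= _ < _) _) (mangoldt_log_sum _ _) (ln _) (psi _) => s m l p.
move: x%:R x0' (g + 1) => X X0 G G0 hl hm p0 hp hE.
have -> : p * l + s - 2 * X * l =
  ((p - X + G) * l + (s - X * m + G * p)) + X * (m - l) - G * (l + p) by ring.
have b1 : `|X * (m - l)| <= M * X.
  by rewrite normrM gtr0_norm // mulrC ler_pM2r.
have b2 : `|G * (l + p)| <= `|G| * (1 + C) * X.
  rewrite normrM -mulrA ler_wpM2l // mulrDl mul1r.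
  by apply: (le_trans (ler_normD _ _)); apply: lerD => //; rewrite ger0_norm.
rewrite [leRHS]mulrDl [X in _ <= X + _]mulrDl.
apply: (le_trans (ler_normB _ _)); apply: lerD => //.
by apply: (le_trans (ler_normD _ _)); apply: lerD.
Qed.
End Selberg.

(** * Selberg's formula on an interval *)

Section ShortIntervals.
Variable R : realType.
Local Notation psi := (chebyshev_psi R).
Local Notation mangoldt := (von_mangoldt R).

(** The formula at [y] is subtracted from that at [z]; replacing ln y by ln z costs O(z), because y
    ln(z / y) <= z. *)
Lemma selberg_difference : exists2 A : R, 0 <= A & forall y z, (0 < y <= z)%N ->
  `|(psi z - psi y) * ln z%:R
    + \sum_(1 <= n < z.+1) mangoldt n * (psi (z %/ n) - psi (y %/ n))
    - 2 * (z%:R - y%:R) * ln z%:R| <= A * z%:R.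
Proof.
have [A A0 hA] := selberg_formula R; have [C C0 hC] := chebyshev R.
exists (2 * A + C + 2) => [|y z /andP[y0 yz]]; first by lra.
have z0 : (0 < z)%N by exact: leq_trans yz.
have y0' : 0 < y%:R :> R by rewrite ltr0n.
have z0' : 0 < z%:R :> R by rewrite ltr0n.
have yz' : y%:R <= z%:R :> R by rewrite ler_nat.
have -> : \sum_(1 <= n < z.+1) mangoldt n * (psi (z %/ n) - psi (y %/ n)) =
  \sum_(1 <= n < z.+1) mangoldt n * psi (z %/ n) - \sum_(1 <= n < y.+1) mangoldt n * psi (y %/ n).
  under eq_bigr do rewrite mulrBr.
  rewrite sumrB; congr (_ - _).
  rewrite (@big_cat_nat _ _ _ y.+1) //= [X in _ + X]big_nat_cond [X in _ + X]big1 ?addr0 //.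
  by move=> n /andP[/andP[h _] _]; rewrite divn_small // psi0 mulr0.
have hz := hA z z0; have hy := hA y y0.
have ly : ln y%:R <= ln z%:R :> R by rewrite ler_ln.
have hl : y%:R * (ln z%:R - ln y%:R) <= z%:R :> R.
  have := ln_le_sub1 (divr_gt0 z0' y0'); rewrite ln_div ?posrE // => h.
  have := ler_wpM2l (ltW y0') h.
  have -> : y%:R * (z%:R / y%:R - 1) = z%:R - y%:R :> R by field; rewrite gt_eqF.
  by move=> h'; apply: (le_trans h'); rewrite lerBlDr lerDl ler0n.
have := hC y; have := psi_ge0 R y; move: hz hy hl ly.
move: (\sum_(_ <= _ < _) _) (\sum_(_ <= _ < _) _) (psi z) (psi y) => Ty Tz pz py.
move: (z%:R : R) (y%:R : R) y0' z0' yz' => Z Y Y0 Z0 YZ.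
move: (ln Z) (ln Y) => lz ly hz hy hl hly p0 hp.
have -> : (pz - py) * lz + (Tz - Ty) - 2 * (Z - Y) * lz =
  (pz * lz + Tz - 2 * Z * lz) - (py * ly + Ty - 2 * Y * ly) + (2 * (Y * (lz - ly)) - py * (lz - ly)) by ring.
have h1 : 0 <= Y * (lz - ly) by nra.
have h2 : 0 <= py * (lz - ly) by nra.
have h3 : py * (lz - ly) <= C * Z by nra.
have h4 : A * Y <= A * Z by nra.
move: hz hy h1 h2 h3 hl; move: (py * (lz - ly)) (Y * (lz - ly)) => u v.
move: (pz * lz + _ - _) (py * ly + _ - _) => a b.
rewrite !ler_norml => /andP[a1 a2] /andP[b1 b2] *; apply/andP; split; nra.
Qed.

(** The sum in [selberg_difference] is nonnegative: it is dropped and the rest divided by ln z >= A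
    / eps. *)
Lemma psi_short_interval (eps : R) : 0 < eps -> exists W : nat, forall y z,
  (y <= z)%N -> (W <= z)%N -> psi z - psi y <= 2 * (z%:R - y%:R) + eps * z%:R.
Proof.
move=> e0; have [A A0 hA] := selberg_difference.
have [W hW] := nat_above (expR (A / eps)).
exists W.+1; suff key y z : (0 < y <= z)%N -> (W.+1 <= z)%N ->
    psi z - psi y <= 2 * (z%:R - y%:R) + eps * z%:R.
  move=> y z yz Wz; have [y0|y0] := posnP y; last by apply: key; rewrite ?y0.
  have psi1 : psi 1 = 0 by rewrite /chebyshev_psi big_nat1 /von_mangoldt.
  rewrite y0 psi0 -psi1; apply: le_trans (key 1%N z _ Wz) _; first by lia.
  by rewrite lerD2r ler_wpM2l // lerD2l lerN2 ler0n.
move=> yz Wz; have := hA y z yz; case/andP: (yz) => y0 yz'.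
have z0 : (0 < z)%N by lia.
have z0' : 0 < z%:R :> R by rewrite ltr0n.
have lz : A / eps <= ln z%:R :> R.
  rewrite -ler_expR lnK ?posrE //; apply: (le_trans hW); rewrite ler_nat; lia.
have S0 : 0 <= \sum_(1 <= n < z.+1) mangoldt n * (psi (z %/ n) - psi (y %/ n)).
  apply: sumr_ge0 => n _; rewrite mulr_ge0 ?mangoldt_ge0 // subr_ge0 psi_le // leq_div2r //.
have lpos : 0 < ln z%:R :> R.
  rewrite ln_gt0 // ltr1n.
  have : (0 < W)%N by rewrite -(ltr0n R); apply: lt_le_trans hW; exact: expR_gt0.
  lia.
move: lz S0 lpos; rewrite ler_pdivrMr // ler_norml.
move: (ln _) (\sum_(_ <= _ < _) _) (psi z - psi y) => l S p lA S0 l0 /andP[_ h].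
rewrite -(ler_pM2r l0); nra.
Qed.

End ShortIntervals.

(** * Chains of dense integers *)

Section Chain.
Variables (R : realType) (x z W : nat) (lam tau : R).
Local Notation psi := (chebyshev_psi R).

Definition short_gain (n : nat) : R := psi (z %/ n) - psi (x %/ n).

(* [n] is dense when the interval (x/n, z/n] carries about twice its length,
   the largest mass that Selberg's formula allows. *)
Definition dense (n : nat) : bool :=
  2 * (z%:R - x%:R) - tau / 4 * z%:R <= n%:R * short_gain n.

Hypothesis z_gt0 : (0 < z)%N.
Hypothesis lam_gt1 : 1 < lam.
Hypothesis tau_gt0 : 0 < tau.
Hypothesis ratio : x%:R / z%:R <= lam^-1 + tau / 4.
Hypothesis psi_short : forall a b, (a <= b)%N -> (W <= b)%N ->
  psi b - psi a <= 2 * (b%:R - a%:R) + tau / 8 * b%:R.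
Hypothesis W_large : 2 <= tau / 4 * W%:R.

Let lam_gt0 : 0 < lam. Proof. by apply: lt_trans lam_gt1. Qed.

(** If x/n lies below z/m, the mass of (x/n, z/m], bounded by [psi_short], is taken off that of
    (x/n, z/n]. Otherwise (z/m, z/n] contains the dense interval, and [ratio] with m <= lam n keeps
    x/n within tau/4 * z/n of z/m. *)
Lemma dense_step (n m : nat) : (0 < n < m)%N -> m%:R <= lam * n%:R -> dense n ->
  (W <= z %/ m)%N ->
  2 * (z%:R / n%:R - z%:R / m%:R) - tau * (z%:R / n%:R) <= psi (z %/ n) - psi (z %/ m).
Proof.
move=> /andP[n0 nm] mn gn Wm; have m0 : (0 < m)%N := ltn_trans n0 nm.
have n0' : 0 < n%:R :> R by rewrite ltr0n.
have m0' : 0 < m%:R :> R by rewrite ltr0n.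
have z0' : 0 < z%:R :> R by rewrite ltr0n.
set a := z%:R / n%:R; set b := z%:R / m%:R; pose c : R := x%:R / n%:R.
have a0 : 0 < a by rewrite divr_gt0.
have ba : b <= a by rewrite ler_pM2l // lef_pV2 ?posrE // ler_nat ltnW.
have gn' : 2 * (a - c) - tau / 4 * a <= short_gain n.
  move: gn; rewrite /dense [n%:R * _]mulrC -ler_pdivrMr // => h; apply: le_trans h.
  by rewrite /a /c le_eqVlt; apply/orP; left; apply/eqP; ring.
have zb : (z %/ m)%:R <= b by exact: floor_div_le.
have xc : c < (x %/ n)%:R + 1 by exact: floor_div_gt.
have Wm' : W%:R <= (z %/ m)%:R :> R by rewrite ler_nat.
have t4 : 0 <= tau / 4 by have := tau_gt0; lra.
have t8 : 0 <= tau / 8 by have := tau_gt0; lra.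
have za : (z %/ m)%:R <= a by exact: le_trans ba.
have ta : 0 <= tau * a by rewrite mulr_ge0 // ltW.
have tW := ler_wpM2l t4 (le_trans Wm' za).
have tb := ler_wpM2l t8 za.
move: gn'; rewrite /short_gain => gn'.
have [h|h] := leqP (x %/ n) (z %/ m).
  by have := psi_short h Wm; have := W_large; lra.
have := psi_le R (ltnW h).
have ca : c = x%:R / z%:R * a by rewrite /c /a; field; rewrite !gt_eqF.
have cl : c <= lam^-1 * a + tau / 4 * a by rewrite ca -mulrDl ler_pM2r.
have bl : lam^-1 * a <= b.
  rewrite /a /b mulrCA ler_pM2l // -invfM lef_pV2 ?posrE ?mulr_gt0 //.
by lra.
Qed.

Variables (T0 T : nat).
Hypothesis T0_gt0 : (0 < T0)%N.
Hypothesis T_small : (T * W <= z)%N.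
Hypothesis covered : forall t, (T0 <= t)%N -> lam * t%:R <= T%:R ->
  exists n, [/\ dense n, (t < n)%N & n%:R <= lam * t%:R].

Lemma W_le_div (m : nat) : (0 < m)%N -> m%:R <= T%:R :> R -> (W <= z %/ m)%N.
Proof.
rewrite ler_nat => m0 mT; rewrite leq_divRL //; apply: leq_trans T_small.
by rewrite mulnC leq_mul2r mT orbT.
Qed.

(* Taking the largest admissible first successor makes the second one jump by
   a factor [lam], so the chain needs a bounded number of steps. *)
Lemma dense_two_steps (n : nat) : (T0 <= n)%N -> dense n -> lam ^+ 2 * n%:R <= T%:R ->
  exists m, [/\ dense m, lam * n%:R <= m%:R, m%:R <= lam ^+ 2 * n%:R &
    2 * (z%:R / n%:R - z%:R / m%:R) - 2 * tau * (z%:R / n%:R) <= psi (z %/ n) - psi (z %/ m)].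
Proof.
move=> Tn gn nT; have n0 : (0 < n)%N := leq_trans T0_gt0 Tn.
have n0' : 0 < n%:R :> R by rewrite ltr0n.
have lT : lam * n%:R <= T%:R.
  by apply: le_trans nT; rewrite expr2 -mulrA ler_peMl ?mulr_ge0 // ltW.
pose P m := dense m && ((n < m)%N && (m%:R <= lam * n%:R)).
have exP : exists m, P m by have [m [h1 h2 h3]] := covered Tn lT; exists m; apply/and3P.
have ubP m : P m -> (m <= T)%N.
  by move=> /and3P[_ _ h]; rewrite -(ler_nat R); apply: le_trans lT.
case: (ex_maxnP exP ubP) => m /and3P[gm nm mn] maxm.
have mn2 : lam * m%:R <= lam ^+ 2 * n%:R by rewrite expr2 -mulrA ler_pM2l.
have [p [gp mp pm]] : exists p, [/\ dense p, (m < p)%N & p%:R <= lam * m%:R].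
  by apply: covered; [exact: ltnW (leq_ltn_trans Tn nm)|exact: le_trans nT].
have np : lam * n%:R <= p%:R.
  rewrite leNgt; apply/negP => pn; have : (p <= m)%N; last by rewrite leqNgt mp.
  by apply: maxm; rewrite /P gp (ltn_trans nm mp) ltW.
exists p; split => //; first exact: le_trans mn2.
have s1 : 2 * (z%:R / n%:R - z%:R / m%:R) - tau * (z%:R / n%:R) <= psi (z %/ n) - psi (z %/ m).
  by apply: dense_step; rewrite ?n0 // W_le_div //; [exact: ltn_trans nm|exact: le_trans lT].
have s2 : 2 * (z%:R / m%:R - z%:R / p%:R) - tau * (z%:R / m%:R) <= psi (z %/ m) - psi (z %/ p).
  apply: dense_step; rewrite ?mp ?andbT //; first exact: ltn_trans nm.
  by apply: W_le_div; [exact: ltn_trans (ltn_trans n0 nm) mp|apply: (le_trans pm); exact: le_trans nT].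
have zmn : z%:R / m%:R <= z%:R / n%:R :> R.
  by apply: ler_wpM2l => //; rewrite lef_pV2 ?posrE ?ltr0n ?ler_nat ?(ltnW nm) ?(ltn_trans n0 nm).
have := ler_wpM2l (ltW tau_gt0) zmn.
lra.
Qed.

Lemma dense_chain (j n : nat) : (T0 <= n)%N -> dense n -> lam ^+ j.*2 * n%:R <= T%:R ->
  exists m, [/\ dense m, lam ^+ j * n%:R <= m%:R, m%:R <= lam ^+ j.*2 * n%:R &
    2 * (z%:R / n%:R - z%:R / m%:R) - 2 * j%:R * tau * (z%:R / n%:R) <= psi (z %/ n) - psi (z %/ m)].
Proof.
move=> Tn gn; have n0 : (0 < n)%N := leq_trans T0_gt0 Tn.
have n0' : 0 < n%:R :> R by rewrite ltr0n.
elim: j => [|j IH] hT.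
  by exists n; split; rewrite ?mul1r // !subrr !(mulr0, mul0r) subrr.
have l2 : 1 <= lam ^+ 2 by rewrite exprn_ege1 // ltW.
have lj : 0 < lam ^+ j.*2 by rewrite exprn_gt0.
have lj1 : 1 <= lam ^+ j by rewrite exprn_ege1 // ltW.
have eS : lam ^+ j.+1.*2 = lam ^+ 2 * lam ^+ j.*2 by rewrite doubleS -exprD.
move: hT; rewrite eS -mulrA => hT.
have [|m [gm m1 m2 m3]] := IH.
  by apply: le_trans hT; rewrite ler_peMl // mulr_ge0 // ltW.
have nm : (n <= m)%N.
  by rewrite -(ler_nat R); apply: le_trans m1; rewrite ler_peMl // ltW.
have [||p [gp p1 p2 p3]] := dense_two_steps _ gm; first exact: leq_trans nm.
  by apply: le_trans hT; rewrite ler_pM2l // exprn_gt0.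
exists p; split => //.
- by rewrite exprS -mulrA; apply: le_trans p1; rewrite ler_pM2l // exprn_gt0.
- by apply: (le_trans p2); rewrite ler_pM2l // exprn_gt0.
have zmn : z%:R / m%:R <= z%:R / n%:R :> R.
  by apply: ler_wpM2l => //; rewrite lef_pV2 ?posrE ?ltr0n ?ler_nat ?nm ?(leq_trans n0 nm).
have := ler_wpM2l (ltW tau_gt0) zmn; rewrite -natr1.
lra.
Qed.

(** With a = z / n, a chain over a factor of at least 10 gives psi(z / n) >= (9/5 - 2 k tau) a >=
    71/40 a, while Chebyshev allows only 70/40 a + C with C < W / 40 <= a / 40. *)
Lemma dense_chain_contradiction (k : nat) (C : R) :
  (forall n, psi n <= 7 / 4 * n%:R + C) -> 40 * C < W%:R -> 0 <= C ->
  10 <= lam ^+ k -> 80 * k%:R * tau <= 1 -> lam ^+ k.*2.+1 * T0%:R <= T%:R -> False.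
Proof.
move=> hC CW C0 lk kt hT.
have t0' : 0 < T0%:R :> R by rewrite ltr0n.
have l2k : 1 <= lam ^+ k.*2 by rewrite exprn_ege1 // ltW.
have hT' : lam ^+ k.*2 * (lam * T0%:R) <= T%:R by rewrite mulrA -exprSr.
have l0 : 0 <= lam * T0%:R by rewrite mulr_ge0 // ltW.
have [|n [gn Tn nT]] := covered (leqnn T0).
  by apply: le_trans hT'; rewrite ler_peMl.
have n0 : (0 < n)%N := ltn_trans T0_gt0 Tn.
have n0' : 0 < n%:R :> R by rewrite ltr0n.
have [||m [gm m1 m2 m3]] := @dense_chain k n _ gn; first exact: ltnW.
  by apply: le_trans hT'; rewrite ler_pM2l // exprn_gt0.
have Wn : (W <= z %/ n)%N.
  apply: W_le_div => //; apply: (le_trans nT).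
  by apply: le_trans hT'; rewrite ler_peMl.
have Wn' : W%:R <= z%:R / n%:R :> R.
  by apply: (le_trans _ (floor_div_le R z n0)); rewrite ler_nat.
have mn : 10 * n%:R <= m%:R :> R by apply: le_trans m1; rewrite ler_pM2r.
have m0' : 0 < m%:R :> R by lra.
have zm : z%:R / m%:R <= (z%:R / n%:R) / 10 :> R.
  rewrite -mulrA -invfM; apply: ler_wpM2l => //.
  by rewrite lef_pV2 ?posrE ?mulr_gt0 // mulrC.
have h1 := hC (z %/ n)%N; have h2 := floor_div_le R z n0; have h3 := psi_ge0 R (z %/ m)%N.
move: m3 h1 h2 h3 zm Wn'; move: (z%:R / n%:R) (z%:R / m%:R) => a b m3 h1 h2 h3 zm Wn'.
have a0 : 0 <= a by apply: le_trans Wn'.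
have : 80 * k%:R * tau * a <= 1 * a by apply: ler_wpM2r.
by lra.
Qed.

End Chain.

(** * The logarithmic average of the defect *)

Section Defect.
Variable R : realType.
Local Notation psi := (chebyshev_psi R).
Local Notation mangoldt := (von_mangoldt R).

(** For z > 0, [n] is dense exactly when this is at most tau / 4. *)
Definition defect (x z n : nat) : R :=
  (2 * (z%:R - x%:R) - n%:R * short_gain R x z n) / z%:R.

(** The added terms make the defect nonnegative: 2 eps where the short-interval bound applies,
    Chebyshev's constant [C] where z / n falls below [W]. *)
Definition defect_bound (C eps : R) (W x z n : nat) : R :=
  defect x z n + 2 * eps + C * (z %/ n < W)%N%:R.

Lemma mangoldt_log_sum_tail (W z : nat) : (0 < W)%N -> (W <= z)%N ->
  \sum_(1 <= n < z.+1) mangoldt n / n%:R * (z %/ n < W)%N%:R =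
  mangoldt_log_sum R z - mangoldt_log_sum R (z %/ W).
Proof.
move=> W0 Wz; have hz : (z %/ W <= z)%N by exact: leq_div.
rewrite /mangoldt_log_sum [X in _ = X - _](@big_cat_nat _ _ _ (z %/ W).+1) //= addrAC subrr add0r.
rewrite (@big_cat_nat _ _ _ (z %/ W).+1) //= [X in X + _]big_nat_cond [X in X + _]big1 ?add0r.
  apply: eq_big_nat => n /andP[h1 h2].
  by rewrite ltn_divLR ?(leq_trans _ h1) // mulnC -ltn_divLR // h1 mulr1.
move=> n /andP[/andP[n0 h] _].
by rewrite ltn_divLR // mulnC -ltn_divLR // ltnNge -ltnS h mulr0.
Qed.

(** By Mertens the term 2 (z - x) of the defect averages to the main term of [selberg_difference],
    so only the growth of psi on (x, z] is left. The [C] terms concern n > z / W, of bounded total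
    weight. *)
Lemma defect_bound_sum (eps : R) (W : nat) : 0 < eps -> (0 < W)%N ->
  (forall a b, (a <= b)%N -> (W <= b)%N ->
    psi b - psi a <= 2 * (b%:R - a%:R) + eps * b%:R) ->
  2 <= eps * W%:R ->
  exists C K : R, forall x z, (0 < x <= z)%N -> (W <= z)%N ->
    (forall n, (0 < n <= z)%N ->
       0 <= defect_bound C eps W x z n /\ defect x z n <= defect_bound C eps W x z n) /\
    \sum_(1 <= n < z.+1) mangoldt n / n%:R * defect_bound C eps W x z n <=
      ((psi z - psi x) / z%:R + 2 * eps) * ln z%:R + K.
Proof.
move=> e0 W0 short eW.
have [C C0 hC] := chebyshev R; have [M M0 hM] := mertens R.
have [A A0 hA] := selberg_difference R.
exists C, (2 * M + A + 2 * eps * M + C * (ln (2 * W%:R) + 2 * M)) => x z xz Wz.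
case/andP: (xz) => x0 xz'; have z0 : (0 < z)%N by lia.
have z0' : 0 < z%:R :> R by rewrite ltr0n.
have W0' : 0 < W%:R :> R by rewrite ltr0n.
have zx : 0 <= z%:R - x%:R :> R by rewrite subr_ge0 ler_nat.
split.
  move=> n /andP[n0 nz]; have n0' : 0 < n%:R :> R by rewrite ltr0n.
  rewrite /defect_bound; have [Wn|Wn] := ltnP (z %/ n) W.
    rewrite mulr1; have h : - C <= defect x z n; last by split; lra.
    rewrite /defect ler_pdivlMr //.
    have h1 : n%:R * short_gain R x z n <= n%:R * (C * (z %/ n)%:R).
      apply: ler_wpM2l => //; rewrite /short_gain.
      by have := hC (z %/ n)%N; have := psi_ge0 R (x %/ n)%N; lra.
    have h2 : C * (n%:R * (z %/ n)%:R) <= C * z%:R.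
      by apply: ler_wpM2l => //; rewrite -natrM ler_nat mulnC leq_divM.
    by rewrite mulrCA in h1; lra.
  rewrite mulr0 addr0; have h : - (2 * eps) <= defect x z n; last by split; lra.
  rewrite /defect ler_pdivlMr //.
  have h1 : n%:R * short_gain R x z n <=
      n%:R * (2 * ((z %/ n)%:R - (x %/ n)%:R) + eps * (z %/ n)%:R).
    by apply: ler_wpM2l => //; apply: short => //; exact: leq_div2r.
  have h2 : n%:R * (z %/ n)%:R <= z%:R :> R by rewrite -natrM ler_nat mulnC leq_divM.
  (* Rounding x / n down costs 2 n <= eps n W <= eps z, the second of the two eps. *)
  have h3 : x%:R <= n%:R * (x %/ n)%:R + n%:R :> R.
    by rewrite -natrM -natrD ler_nat addnC mulnC -mulSn ltnW // ltn_ceil.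
  have h4 : n%:R * W%:R <= z%:R :> R.
    by rewrite -natrM ler_nat mulnC -leq_divRL.
  have h5 : eps * (n%:R * (z %/ n)%:R) <= eps * z%:R by apply: ler_wpM2l => //; exact: ltW.
  have h6 : eps * (n%:R * W%:R) <= eps * z%:R by apply: ler_wpM2l => //; exact: ltW.
  have h7 := ler_wpM2l (ltW n0') eW.
  by lra.
have -> : \sum_(1 <= n < z.+1) mangoldt n / n%:R * defect_bound C eps W x z n =
  (2 * (z%:R - x%:R) * mangoldt_log_sum R z
     - \sum_(1 <= n < z.+1) mangoldt n * short_gain R x z n) / z%:R
  + 2 * eps * mangoldt_log_sum R z
  + C * (mangoldt_log_sum R z - mangoldt_log_sum R (z %/ W)).
  rewrite -mangoldt_log_sum_tail // /mangoldt_log_sum !big_distrr /= -sumrB big_distrl /= -!big_split /=.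
  apply: eq_big_nat => n /andP[n0 _]; rewrite /defect_bound /defect.
  by field; rewrite !gt_eqF ?ltr0n.
have q0 : (0 < z %/ W)%N by rewrite divn_gt0.
have lq : ln z%:R - ln (2 * W%:R) <= ln (z %/ W)%:R :> R.
  rewrite -ln_div ?posrE ?mulr_gt0 // ler_ln ?posrE ?divr_gt0 ?mulr_gt0 ?ltr0n //.
  have := floor_div_gt R z W0; have : 1 <= (z %/ W)%:R :> R by rewrite ler1n.
  rewrite ltr_pdivrMr // ler_pdivrMr ?mulr_gt0 //; nra.
have l0 : 0 <= ln z%:R :> R by rewrite ln_ge0 // ler1n.
have := hA x z xz; have := hM _ z0; have := hM _ q0; rewrite /short_gain.
have pz : psi x <= psi z by exact: psi_le.
have X0 : 0 <= x%:R :> R by [].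
move: lq l0 z0' zx pz X0; move: (\sum_(_ <= _ < _) _) (mangoldt_log_sum _ _) (mangoldt_log_sum _ _).
move: (ln (_ %/ _)%:R) (z%:R : R) => lW Z S mW m.
move: (ln (2 * _)) (ln _) (x%:R : R) (psi z) (psi x) => l2 l X pz px.
move=> lq l0 Z0 ZX pxz X0; rewrite !ler_norml => /andP[hq1 _] /andP[hz1 hz2] /andP[hS _].
have e1 : (2 * (Z - X) * mW - S) / Z <= (pz - px) / Z * l + A + 2 * M.
  rewrite ler_pdivrMr // -/(_ / _).
  have -> : ((pz - px) / Z * l + A + 2 * M) * Z = (pz - px) * l + A * Z + 2 * M * Z.
    by field; rewrite gt_eqF.
  have h1 : 2 * (Z - X) * (mW - l) <= 2 * (Z - X) * M by apply: ler_wpM2l; lra.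
  have h2 : X * M >= 0 by rewrite mulr_ge0.
  by lra.
have e2 : 2 * eps * mW <= 2 * eps * (l + M) by apply: ler_wpM2l; lra.
have e3 : C * (mW - m) <= C * (l2 + 2 * M) by apply: ler_wpM2l => //; lra.
by lra.
Qed.
End Defect.

(** * Ratios along which psi grows proportionally *)

Section PositiveGrowth.
Variable R : realType.
Local Notation psi := (chebyshev_psi R).

(** Its negation is badness of [lam]: for each [d], the growth on (y, lam y] is below d y for
    arbitrarily large y. *)
Definition positive_growth (lam : R) : Prop :=
  exists2 d : R, 0 < d & exists Y : nat, forall y, (Y <= y)%N ->
    d * y%:R <= psi (Num.truncn (lam * y%:R)) - psi y.

Lemma psi_growth_ge (m n : nat) : (0 < m <= n)%N ->
  m%:R * (mangoldt_log_sum R n - mangoldt_log_sum R m) <= psi n - psi m.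
Proof.
move=> /andP[m0 mn]; rewrite psi_sub // /mangoldt_log_sum.
rewrite (@big_cat_nat _ _ _ m.+1 1 n.+1) //= addrAC subrr add0r big_distrr /=.
apply: ler_sum_nat => d /andP[md _].
have d0 : 0 < d%:R :> R by rewrite ltr0n (leq_trans _ md).
rewrite mulrCA -[leRHS]mulr1; apply: ler_wpM2l; first exact: mangoldt_ge0.
by rewrite ler_pdivrMr // mul1r ler_nat ltnW.
Qed.

(** By Mertens, Lambda(n) / n sums to at least ln Q - 2 M >= 1 over (y, Q y]. *)
Lemma positive_growth_large : exists2 L : R, 1 < L & forall lam, L <= lam -> positive_growth lam.
Proof.
have [M M0 hM] := mertens R.
have [Q hQ] := nat_above (expR (2 * M + 1)).
have Q0 : 0 < Q%:R :> R by apply: lt_le_trans hQ; exact: expR_gt0.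
have lQ : 2 * M + 1 <= ln Q%:R by rewrite -ler_expR lnK.
have Q1 : 1 < Q%:R :> R.
  by rewrite ltNge; apply/negP => /ln_le0; lra.
exists Q%:R => // lam hlam; exists 1 => //; exists 1%N => y y0.
have y0' : 0 < y%:R :> R by rewrite ltr0n.
have Qy : (Q * y <= Num.truncn (lam * y%:R))%N.
  rewrite truncn_ge_nat ?natrM ?ler_pM2r //; apply: mulr_ge0 => //; lra.
apply: (le_trans _ (lerB (psi_le R Qy) (lexx _))).
have yQ : (0 < y <= Q * y)%N by rewrite y0 leq_pmull // -(ltr0n R).
apply: (le_trans _ (psi_growth_ge yQ)); rewrite mulrC ler_pM2l //.
have := hM _ y0; have := hM (Q * y)%N; rewrite muln_gt0 y0 -(ltr0n R) Q0 => /(_ isT).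
rewrite natrM lnM ?posrE // !ler_norml => /andP[h1 _] /andP[_ h2]; lra.
Qed.

Lemma expr_above (a b : R) : 1 < a -> exists k : nat, b <= a ^+ k.
Proof.
move=> a1; have [k hk] := nat_above (b / (a - 1)); exists k.
have bern : forall j, 1 + j%:R * (a - 1) <= a ^+ j.
  elim=> [|j IH]; first by rewrite mul0r addr0 expr0.
  rewrite exprS -natr1; have : 0 <= j%:R * (a - 1) ^+ 2 by rewrite mulr_ge0 ?sqr_ge0.
  have : a * (1 + j%:R * (a - 1)) <= a * a ^+ j by apply: ler_wpM2l => //; lra.
  by move: (a * a ^+ j) => b' h1 h2; apply: le_trans h1; lra.
apply: le_trans (bern k); move: hk; rewrite ler_pdivrMr; lra.
Qed.

(** The ratios rho^j lam0 start bad and are eventually good, so some step passes from bad to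
    good. *)
Lemma growth_threshold (lam0 rho : R) : 1 < lam0 -> 1 < rho -> ~ positive_growth lam0 ->
  exists2 lam, lam0 <= lam & ~ positive_growth lam /\ positive_growth (rho * lam).
Proof.
move=> l1 r1 n0; have [L L1 hL] := positive_growth_large.
have [k hk] := expr_above L r1.
apply: contrapT => hno.
have all_n j : ~ positive_growth (rho ^+ j * lam0).
  elim: j => [|j IH]; first by rewrite mul1r.
  move=> h; apply: hno; exists (rho ^+ j * lam0); last by rewrite mulrA -exprS.
  by rewrite ler_peMl ?exprn_ege1 //; lra.
apply: (all_n k); apply: hL; apply: (le_trans hk).
by rewrite ler_peMr ?exprn_ge0 //; lra.
Qed.

End PositiveGrowth.

(** * Windows without dense integers *)

Section UncoveredBlocks.
Variable R : realType.
Local Notation psi := (chebyshev_psi R).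
Local Notation mangoldt := (von_mangoldt R).

(** Each n in (t, lam t] has defect above tau / 4 and weight at least Lambda(n) / (lam t), and psi
    grows by at least d t there. *)
Lemma uncovered_defect (x z T0 T t : nat) (lam tau d : R) (E : nat -> R) :
  1 < lam -> 0 < tau ->
  (forall n, (0 < n <= z)%N -> 0 <= E n /\ defect R x z n <= E n) ->
  (0 < t)%N -> (T0 <= t)%N -> lam * t%:R <= T%:R -> (T <= z)%N ->
  (forall n, (t < n)%N -> n%:R <= lam * t%:R -> ~~ dense x z tau n) ->
  d * t%:R <= psi (Num.truncn (lam * t%:R)) - psi t ->
  tau / 4 * d / lam <= \sum_(T0.+1 <= n < T.+1) mangoldt n / n%:R * E n.
Proof.
move=> lam1 tau0 hE t0 T0t tT Tz nd hd.
have l0 : 0 < lam by lra.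
have t0' : 0 < t%:R :> R by rewrite ltr0n.
have lt0 : 0 < lam * t%:R by rewrite mulr_gt0.
set v := Num.truncn (lam * t%:R) in hd.
have vl : v%:R <= lam * t%:R by rewrite truncn_le // ltW.
have vT : (v <= T)%N by rewrite -(ler_nat R); exact: le_trans tT.
have tv : (t <= v)%N by rewrite truncn_ge_nat ?(ltW lt0) // ler_peMl // ltW.
have w0 n : (0 < n <= z)%N -> 0 <= mangoldt n / n%:R * E n.
  by move=> nz; apply: mulr_ge0; [rewrite divr_ge0 ?mangoldt_ge0|have [] := hE n nz].
rewrite (@big_cat_nat _ _ _ t.+1) //=; last by rewrite ltnS (leq_trans tv).
rewrite [X in _ <= _ + X](@big_cat_nat _ _ _ v.+1) //=.
have s1 : 0 <= \sum_(T0.+1 <= n < t.+1) mangoldt n / n%:R * E n.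
  rewrite big_nat_cond; apply: sumr_ge0 => n /andP[/andP[h1 h2] _]; apply: w0.
  by apply/andP; split; [exact: leq_ltn_trans h1|
     apply: leq_trans Tz; apply: leq_trans vT; apply: leq_trans tv].
have s3 : 0 <= \sum_(v.+1 <= n < T.+1) mangoldt n / n%:R * E n.
  rewrite big_nat_cond; apply: sumr_ge0 => n /andP[/andP[h1 h2] _]; apply: w0.
  by apply/andP; split; [exact: leq_ltn_trans h1|apply: leq_trans Tz].
have s2 : (psi v - psi t) * (tau / 4 / (lam * t%:R)) <=
    \sum_(t.+1 <= n < v.+1) mangoldt n / n%:R * E n.
  rewrite psi_sub // big_distrl /=; apply: ler_sum_nat => n /andP[tn nv].
  have n0 : (0 < n)%N by exact: leq_ltn_trans tn.
  have n0' : 0 < n%:R :> R by rewrite ltr0n.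
  have nz : (0 < n <= z)%N.
    by rewrite n0; apply: leq_trans Tz; apply: leq_trans vT.
  have nl : n%:R <= lam * t%:R by apply: le_trans vl; rewrite ler_nat.
  have z0' : 0 < z%:R :> R by rewrite ltr0n; case/andP: nz => h1 h2; exact: leq_trans h2.
  have tauE : tau / 4 <= E n.
    have [_] := hE n nz; apply: le_trans; rewrite /defect ler_pdivlMr //.
    by have := nd n tn nl; rewrite /dense -ltNge => /ltW; lra.
  rewrite -[leRHS]mulrA; apply: ler_wpM2l; first exact: mangoldt_ge0.
  rewrite mulrC; apply: ler_pM => //; rewrite ?invr_ge0 ?(ltW lt0) //; first by lra.
  by rewrite lef_pV2 ?posrE.
have s4 : tau / 4 * d / lam <= (psi v - psi t) * (tau / 4 / (lam * t%:R)).
  have -> : tau / 4 * d / lam = d * t%:R * (tau / 4 / (lam * t%:R)).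
    by field; rewrite !gt_eqF.
  by apply: ler_wpM2r => //; rewrite divr_ge0 ?(ltW lt0) //; lra.
by apply: (le_trans s4); apply: (le_trans s2); lra.
Qed.

Lemma sum_blocks_ge (f : nat -> R) (U b z : nat) (s : R) : (0 < U)%N ->
  (forall i, (b <= i)%N -> (U ^ i.+1 <= z)%N -> s <= \sum_((U ^ i).+1 <= n < (U ^ i.+1).+1) f n) ->
  forall j, (U ^ (b + j) <= z)%N ->
  j%:R * s <= \sum_((U ^ b).+1 <= n < (U ^ (b + j)).+1) f n.
Proof.
move=> U0 hb; elim=> [|j IH] hz; first by rewrite mul0r addn0 big_geq.
have hU : (U ^ (b + j) <= U ^ (b + j.+1))%N by rewrite leq_pexp2l // addnS.
rewrite (@big_cat_nat _ _ _ (U ^ (b + j)).+1) //=; last by rewrite ltnS leq_pexp2l // leq_addr.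
rewrite -natr1 mulrDl mul1r; apply: lerD; first exact/IH/(leq_trans hU).
by rewrite addnS; apply: hb; rewrite ?leq_addr // -addnS.
Qed.
End UncoveredBlocks.

(** * Prime powers in every short interval *)

Section ErdosGap.
Variable R : realType.
Local Notation psi := (chebyshev_psi R).
Local Notation mangoldt := (von_mangoldt R).

(** The gap is taken for a bad ratio, the chain for the good one larger by 1 + tau/16; the
    discrepancy and the truncation of z both fit into tau / 4. *)
Lemma gap_ratio (x z lam tau : R) : 0 < z -> 1 < lam -> 0 < tau ->
  lam * x < z + 1 -> 16 <= z * tau -> x / z <= ((1 + tau / 16) * lam)^-1 + tau / 4.
Proof.
move=> z0 lam1 tau0 h h1; have lam0 : 0 < lam by lra.
rewrite invfM ler_pdivrMr // -(ler_pM2l lam0).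
have -> : lam * (((1 + tau / 16)^-1 * lam^-1 + tau / 4) * z) =
     (1 + tau / 16)^-1 * z + lam * tau / 4 * z.
  by field; apply/andP; split; rewrite gt_eqF //; lra.
have h3 : 1 - tau / 16 <= (1 + tau / 16)^-1.
  rewrite -[(1 + tau / 16)^-1]div1r ler_pdivlMr; last by lra.
  by have := sqr_ge0 tau; lra.
have h4 : (1 - tau / 16) * z <= (1 + tau / 16)^-1 * z by rewrite ler_pM2r.
have h5 : 1 * (tau * z) <= lam * (tau * z) by rewrite ler_pM2r ?mulr_gt0 // ltW.
by lra.
Qed.

(** Since 3 e lU = 3/8 sg, the upper bound grows by only 3/8 sg per block, so 5/8 j sg stays
    bounded. *)
Lemma block_count_bound (j B Y e lU lW lz K sg : R) :
  0 < sg -> 0 <= e -> e * lU = sg / 8 ->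
  (3 * e * (lW + (Y + 1) * lU) + K) / (5 / 8 * sg) + 1 <= B -> B <= j ->
  lz <= lW + (j + Y + 1) * lU -> j * sg <= 3 * e * lz + K -> False.
Proof.
move=> sg0 e0 elU hB jB hlz up.
have e3 : 3 * e * lz <= 3 * e * (lW + (j + Y + 1) * lU) by apply: ler_wpM2l => //; lra.
have s5 : 0 < 5 / 8 * sg by lra.
have : (3 * e * (lW + (Y + 1) * lU) + K) / (5 / 8 * sg) < j by lra.
rewrite ltr_pdivrMr // => fin.
have je : 3 * e * (j * lU) = 3 / 8 * j * sg.
  by transitivity (3 * j * (e * lU)); [ring|rewrite elU; field].
by lra.
Qed.

Theorem positive_growth_gt1 (lam0 : R) : 1 < lam0 -> positive_growth lam0.
Proof.
move=> l1; apply: contrapT => n0.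
have [C C0 hC] := psi_le_linear R.
have [k hk] := expr_above 10 l1.
have k0 : (0 < k)%N by rewrite lt0n; apply/eqP => k0; move: hk; rewrite k0 expr0; lra.
have k0' : 0 < k%:R :> R by rewrite ltr0n.
(* [tau] must precede [lam1], which depends on it; hence [k] is chosen for [lam0] and serves every
   larger ratio. *)
pose tau : R := (80 * k%:R)^-1.
have tau0 : 0 < tau by rewrite invr_gt0 mulr_gt0.
have htau : 80 * k%:R * tau = 1 by rewrite divff // mulf_neq0 // gt_eqF.
clearbody tau.
have rho1 : 1 < 1 + tau / 16 by lra.
have [lam1 l01 [ng [d d0 [Y hY]]]] := growth_threshold l1 rho1 n0.
set lam := (1 + tau / 16) * lam1 in hY.
have lam1gt : 1 < lam1 by lra.
have laml : lam1 <= lam by rewrite /lam; nra.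
have lamE : lam = (1 + tau / 16) * lam1 by [].
clearbody lam; have lamgt : 1 < lam by lra.
have lam0' : 0 < lam by lra.
(* A block (U^i, U^(i + 1)] has room for a first dense integer and [k] double steps. *)
have [U hU] := nat_above (lam ^+ k.*2.+1 + 1).
have lk1 : 1 <= lam ^+ k.*2.+1 by rewrite exprn_ege1 // ltW.
have U2 : 2 <= U%:R :> R by lra.
have U1 : (1 < U)%N by move: U2; rewrite ler_nat.
have U0 : (0 < U)%N := ltnW U1.
pose lU : R := ln U%:R; have lU0 : 0 < lU by rewrite ln_gt0; lra.
pose sg := tau / 4 * d / lam.
have sg0 : 0 < sg by rewrite divr_gt0 // mulr_gt0 // divr_gt0.
have sgE : tau / 4 * d / lam = sg by [].
clearbody sg; pose e := sg / (8 * lU); have e0 : 0 < e by rewrite divr_gt0 // mulr_gt0.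
have elU : e * lU = sg / 8 by rewrite /e; field; rewrite gt_eqF.
clearbody e.
pose eps := Num.min (tau / 8) e.
have eps0 : 0 < eps by rewrite lt_min e0 andbT; lra.
have eps_tau : eps <= tau / 8 by rewrite ge_min lexx.
have eps_e : eps <= e by rewrite ge_min lexx orbT.
clearbody eps.
have [W1 hW1] := psi_short_interval eps0.
have [W2 hW2] := nat_above (2 / eps + 8 / tau + 40 * C + 1).
pose W := (W1 + W2)%N.
have e2 : 0 < 2 / eps by rewrite divr_gt0.
have t8 : 0 < 8 / tau by rewrite divr_gt0.
have WW2 : W2%:R <= W%:R :> R by rewrite ler_nat leq_addl.
have W0 : (0 < W)%N by rewrite -(ltr0n R); lra.
have W0' : 0 < W%:R :> R by rewrite ltr0n.
have shortW a b : (a <= b)%N -> (W <= b)%N -> psi b - psi a <= 2 * (b%:R - a%:R) + eps * b%:R.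
  by move=> ab Wb; apply: hW1 => //; apply: leq_trans Wb; exact: leq_addr.
have shortWt a b : (a <= b)%N -> (W <= b)%N -> psi b - psi a <= 2 * (b%:R - a%:R) + tau / 8 * b%:R.
  move=> ab Wb; apply: (le_trans (shortW a b ab Wb)); rewrite lerD2l.
  by apply: ler_wpM2r.
have eW : 2 <= eps * W%:R by rewrite mulrC -ler_pdivrMr //; lra.
have tW : 2 <= tau / 4 * W%:R.
  have : 8 <= W%:R * tau by rewrite -ler_pdivrMr //; lra.
  by lra.
have CW : 40 * C < W%:R by lra.
have [C' [K hK]] := defect_bound_sum eps0 W0 shortW eW.
have [B hB] := nat_above ((3 * e * (ln W%:R + (Y%:R + 1) * lU) + K) / (5 / 8 * sg) + 1).
have [X hX] := nat_above (16 / tau).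
pose Xb := (U ^ (Y + B) * W + W + X + 1)%N.
have [XbU XbW XbX Xb0] : [/\ U ^ (Y + B) * W <= Xb, W <= Xb, X <= Xb & 0 < Xb]%N.
  by rewrite /Xb; move: (_ * W)%N => V; clearbody W; clear; split; lia.
(* Badness of [lam1], tested with density [e], yields the nearly empty interval. *)
clearbody Xb; have [x Xx hx] : exists2 x, (Xb <= x)%N & psi (Num.truncn (lam1 * x%:R)) - psi x < e * x%:R.
  apply: contrapT => hno; apply: ng; exists e => //; exists Xb => y Xy.
  by rewrite leNgt; apply/negP => hy; apply: hno; exists y.
set z := Num.truncn (lam1 * x%:R) in hx.
have x0 : (0 < x)%N := leq_trans Xb0 Xx.
have x0' : 0 < x%:R :> R by rewrite ltr0n.
have lx0 : 0 <= lam1 * x%:R by rewrite mulr_ge0 // ltW // (lt_trans _ lam1gt).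
have xz : (x <= z)%N by rewrite truncn_ge_nat // ler_peMl // ltW.
have z0 : (0 < z)%N := leq_trans x0 xz.
have Xbz : (Xb <= z)%N := leq_trans Xx xz.
have z0' : 0 < z%:R :> R by rewrite ltr0n.
have zgt : lam1 * x%:R < z%:R + 1 by rewrite natr1; have /andP[] := truncn_itv lx0.
have Wz : (W <= z)%N := leq_trans XbW Xbz.
have Xz : X%:R <= z%:R :> R by rewrite ler_nat (leq_trans XbX).
have ratio : x%:R / z%:R <= lam^-1 + tau / 4.
  rewrite lamE; apply: gap_ratio => //.
  by rewrite -ler_pdivrMr //; exact: le_trans Xz.
have xz' : (0 < x <= z)%N by rewrite x0.
have [hE hsum] := hK x z xz' Wz.
pose E := defect_bound C' eps W x z.
have zW0 : (0 < z %/ W)%N by rewrite divn_gt0.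
(* A window without dense integers costs [sg]; if there is none, the block carries a chain that
   contradicts Chebyshev. *)
have block i : (Y <= i)%N -> (U ^ i.+1 <= z %/ W)%N ->
    sg <= \sum_((U ^ i).+1 <= n < (U ^ i.+1).+1) mangoldt n / n%:R * E n.
  move=> Yi Ui.
  have T0pos : (0 < U ^ i)%N by rewrite expn_gt0 U0.
  have Tz : (U ^ i.+1 * W <= z)%N by rewrite -leq_divRL.
  have [hunc|hcov] := pselect (exists t, [/\ (U ^ i <= t)%N, lam * t%:R <= (U ^ i.+1)%:R &
      forall n, (t < n)%N -> n%:R <= lam * t%:R -> ~~ dense x z tau n]).
    case: hunc => t [T0t tT nd].
    have t0 : (0 < t)%N by exact: leq_trans T0t.
    rewrite -sgE; apply: (@uncovered_defect R x z (U ^ i) (U ^ i.+1) t lam tau d E) => //.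
      by apply: leq_trans Tz; rewrite leq_pmulr.
    apply: hY; apply: leq_trans T0t; apply: leq_trans Yi _; apply/ltnW.
    exact: ltn_expl.
  exfalso; apply: (@dense_chain_contradiction R x z W lam tau z0 lamgt tau0 ratio shortWt tW
    (U ^ i)%N (U ^ i.+1)%N T0pos Tz _ k C hC CW C0).
  - move=> t Tt tT; apply: contrapT => hno; apply: hcov; exists t; split => // n tn nt.
    by apply/negP => dn; apply: hno; exists n.
  - apply: (le_trans hk); apply: lerXn2r; rewrite ?nnegrE ?(ltW lam0') ?(le_trans l01) //.
    by rewrite ltW // (lt_trans _ l1).
  - by rewrite htau.
  - rewrite expnS natrM; apply: ler_wpM2r => //; apply: le_trans hU; by rewrite lerDl.
(* The j = b - Y blocks fill (U^Y, z / W] up to a factor U, so j is about ln z / lU. *)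
pose b := trunc_log U (z %/ W).
have bP : (U ^ b <= z %/ W)%N by exact: trunc_logP.
have bS : (z %/ W < U ^ b.+1)%N by exact: trunc_log_ltn.
have Bb : (Y + B <= b)%N.
  apply: trunc_log_max => //; by rewrite leq_divRL // (leq_trans XbU).
pose j := (b - Y)%N.
have jE : (Y + j = b)%N by rewrite subnKC // (leq_trans _ Bb) // leq_addr.
have low := @sum_blocks_ge R (fun n => mangoldt n / n%:R * E n) U Y (z %/ W) sg U0 block j.
rewrite jE in low; have {}low := low bP.
have Ubz : (U ^ b <= z)%N by apply: (leq_trans bP); exact: leq_div.
have w0 n : (0 < n <= z)%N -> 0 <= mangoldt n / n%:R * E n.
  by move=> nz; apply: mulr_ge0; [rewrite divr_ge0 ?mangoldt_ge0|have [] := hE n nz].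
have UYb : (U ^ Y <= U ^ b)%N by rewrite leq_pexp2l // -jE leq_addr.
have low2 : j%:R * sg <= \sum_(1 <= n < z.+1) mangoldt n / n%:R * E n.
  apply: (le_trans low).
  rewrite [leRHS](@big_cat_nat _ _ _ (U ^ b).+1) //= [X in _ <= X + _](@big_cat_nat _ _ _ (U ^ Y).+1) //=.
  rewrite -addrA addrCA lerDl addr_ge0 // big_nat_cond; apply: sumr_ge0 => n /andP[/andP[h1 h2] _].
    by apply: w0; rewrite h1 /= -ltnS; apply: (leq_trans h2); rewrite ltnS (leq_trans UYb).
  by apply: w0; apply/andP; split; [exact: leq_ltn_trans h1|].
have lz : ln z%:R <= ln W%:R + (j%:R + Y%:R + 1) * lU :> R.
  have -> : j%:R + Y%:R + 1 = b.+1%:R :> R by rewrite -jE -natr1 natrD; ring.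
  rewrite mulrC mulr_natr /lU -lnXn ?ltr0n // -natrX -lnM ?posrE ?ltr0n ?expn_gt0 ?U0 //.
  rewrite -natrM ler_ln ?posrE ?ltr0n ?muln_gt0 ?expn_gt0 ?U0 ?W0 // ler_nat ltnW //.
  by rewrite mulnC -ltn_divLR.
have lz0 : 0 <= ln z%:R :> R by rewrite ln_ge0 // ler1n.
have gap : (psi z - psi x) / z%:R <= e.
  rewrite ler_pdivrMr //; apply: (le_trans (ltW hx)); apply: ler_wpM2l; rewrite ?ler_nat //; exact: ltW.
(* One [e] bounds the growth on (x, z], two more bound 2 eps. *)
have up : j%:R * sg <= 3 * e * ln z%:R + K.
  apply: (le_trans low2); apply: (le_trans hsum); rewrite lerD2r; apply: ler_wpM2r => //.
  by move: gap eps_e; move: (_ / _) => q; clear; lra.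
have jB : B%:R <= j%:R :> R by rewrite ler_nat leq_subRL // (leq_trans _ Bb) // leq_addr.
exact: (block_count_bound sg0 (ltW e0) elU hB jB lz up).
Qed.

Theorem prime_power_in_short_interval (d : nat) : (0 < d)%N ->
  exists Y : nat, forall y, (Y <= y)%N ->
  exists p k : nat, [/\ prime p, (0 < k)%N, (y < p ^ k)%N & (d * p ^ k <= d.+1 * y)%N].
Proof.
move=> d0; have d0' : 0 < d%:R :> R by rewrite ltr0n.
have l1 : 1 < d.+1%:R / d%:R :> R by rewrite ltr_pdivlMr // mul1r ltr_nat.
have [c c0 [Y hY]] := positive_growth_gt1 l1.
exists Y.+1 => y Yy; have y0 : (0 < y)%N by lia.
have y0' : 0 < y%:R :> R by rewrite ltr0n.
have := hY y (ltnW Yy); set v := Num.truncn _ => h.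
have {h} : 0 < psi v - psi y by apply: lt_le_trans h; rewrite mulr_gt0.
have ly0 : 0 <= d.+1%:R / d%:R * y%:R :> R by rewrite mulr_ge0 // divr_ge0.
have [yv|vy] := leqP y v; last first.
  by rewrite subr_gt0 ltNge psi_le // ltnW.
rewrite psi_sub // => hs.
have [n /andP[yn nv] Ln] : exists2 n, (y < n < v.+1)%N & mangoldt n != 0.
  apply: contrapT => hno; move: hs; rewrite big_nat_cond big1 ?ltxx // => n /andP[hn _].
  by apply/eqP; apply: contrapT => /negP Ln; apply: hno; exists n.
have [p [k [pp k0 nE]]] := mangoldt_neq0 Ln.
exists p, k; rewrite -nE; split => //.
have : n%:R <= d.+1%:R / d%:R * y%:R :> R.
  by apply: le_trans (_ : v%:R <= _); rewrite ?ler_nat // truncn_le.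
by rewrite mulrAC ler_pdivlMr // -!natrM ler_nat mulnC.
Qed.
End ErdosGap.

(** * The bound *)

Lemma magic_sum_bound (F : realFieldType) (eps t n q s : F) :
  0 < t -> t <= 1 -> 37 * t <= eps -> 0 <= q -> 1 <= n * t -> 1 <= n ->
  q <= (1 + t) * ((12 * n + 4) / 11) -> s <= 2 * q ^+ 2 + 1 ->
  s <= (288 / 121 + eps) * n ^+ 2.
Proof.
move=> t0 t1 te q0 nt n1 hq hs; have n0 : 0 <= n := le_trans ler01 n1.
(* One factor 1 + t is the prime power gap; the other absorbs the 4, as 4 <= 12 n t. *)
pose r := 12 / 11 * n * (1 + t) ^+ 2.
have qr : q <= r.
  apply: (le_trans hq); have -> : r = (1 + t) * (12 * n * (1 + t) / 11) by rewrite /r; field.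
  by apply: ler_wpM2l; lra.
have q2 : q ^+ 2 <= r ^+ 2 by apply: lerXn2r => //; rewrite nnegrE (le_trans q0).
(* Since 288/121 * 15 < 36 and 1 <= t n^2, the total excess is below 37 t n^2. *)
have t4 : (1 + t) ^+ 4 <= 1 + 15 * t.
  have t2 : t ^+ 2 <= t by rewrite expr2 ler_piMr // ltW.
  have t3 : t ^+ 3 <= t by rewrite exprS ler_piMr ?(ltW t0) // (le_trans t2).
  have t4 : t ^+ 4 <= t by rewrite exprS ler_piMr ?(ltW t0) // (le_trans t3).
  have -> : (1 + t) ^+ 4 = 1 + 4 * t + 6 * t ^+ 2 + 4 * t ^+ 3 + t ^+ 4 by ring.
  by lra.
have n2 : 0 <= n ^+ 2 by rewrite sqr_ge0.
have r2 : r ^+ 2 <= 144 / 121 * n ^+ 2 * (1 + 15 * t).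
  have -> : r ^+ 2 = 144 / 121 * n ^+ 2 * (1 + t) ^+ 4 by rewrite /r; field.
  by apply: ler_wpM2l; [rewrite !mulr_ge0 ?invr_ge0|exact: t4].
have en : 37 * t * n ^+ 2 <= eps * n ^+ 2 by apply: ler_wpM2r.
have tn : 1 <= t * n ^+ 2 by rewrite expr2 mulrCA -[1]mul1r ler_pM // mulrC.
by lra.
Qed.

Lemma magic_sum_bound_nat (F : realFieldType) (eps : F) (d n q s : nat) :
  37 / eps < d%:R -> 0 < eps -> (0 < d <= n)%N ->
  (11 * (d * q) <= d.+1 * (12 * n + 4))%N -> (s <= 2 * q ^ 2 + 1)%N ->
  s%:R <= (288%:R / 121%:R + eps) * (n ^ 2)%N%:R.
Proof.
move=> hd eps0 /andP[d0 dn] hq hs; rewrite natrX.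
have d0' : 0 < d%:R :> F by rewrite ltr0n.
have n1 : 1 <= n%:R :> F by rewrite ler1n (leq_trans d0).
apply: (@magic_sum_bound F eps d%:R^-1 n%:R q%:R) => //.
- by rewrite invr_gt0.
- by rewrite invf_le1 // ler1n.
- by rewrite ler_pdivrMr // mulrC -ler_pdivrMr // ltW.
- by rewrite ler_pdivlMr // mul1r ler_nat.
- have -> : (1 + d%:R^-1) * ((12 * n%:R + 4) / 11) = (d.+1 * (12 * n + 4))%:R / (11 * d)%:R :> F.
    by rewrite !(natrM, natrD) -natr1; field; rewrite gt_eqF.
  by rewrite ler_pdivlMr ?ltr0n ?muln_gt0 // -natrM ler_nat mulnC -mulnA.
by rewrite -natrX -natrM natr1 ler_nat -addn1.
Qed.

(* I(K_n) <= (288/121 + o(1)) n^2 : for every eps > 0, for all large n,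
   K_n has an edge-magic injection with magic sum s <= (288/121 + eps) n^2
   (equivalently, the minimum magic sum is at most that bound). *)
Theorem theorem4 :
  forall eps : rat, 0 < eps ->
  exists N : nat, forall n : nat, (N <= n)%N ->
    exists (lv : 'I_n -> nat) (le : {set 'I_n} -> nat) (s : nat),
      edge_magic_injection (complete_graph n) lv le s /\
      (s%:R : rat) <= (288%:R / 121%:R + eps) * (n ^ 2)%N%:R.
Proof.
move=> eps eps0; pose d := (Num.truncn (37 / eps)).+1.
have d0 : (0 < d)%N by [].
have hd : 37 / eps < d%:R :> rat by rewrite /d truncnS_gt.
have [Y hY] := @prime_power_in_short_interval Rdefinitions.R d d0.
exists (Y + d + 2)%N => n hn.
(* As [y] is a floor, any q > y satisfies 12 n + 4 <= 11 q, as [magic_of_prime_power] demands. *)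
pose y := ((12 * n + 4) %/ 11)%N.
have yn : (n <= y)%N by rewrite leq_divRL //; lia.
have [p [k [pp k0 yq qy]]] : exists p k : nat,
    [/\ prime p, (0 < k)%N, (y < p ^ k)%N & (d * p ^ k <= d.+1 * y)%N] by apply: hY; lia.
have hq : (12 * n + 4 <= 11 * p ^ k)%N.
  have := ltn_ceil (12 * n + 4) (isT : (0 < 11)%N); rewrite -/y.
  by move: yq; clear; move: (p ^ k)%N y => Q y; lia.
have q2 : (2 < p ^ k)%N by apply: leq_ltn_trans yq; lia.
have [lv [le [s [mg hs]]]] := magic_of_prime_power pp k0 q2 hq.
exists lv, le, s; split; first exact: mg.
apply: (@magic_sum_bound_nat rat eps d n (p ^ k) s hd eps0 _ _ hs); first by rewrite d0; lia.
have := leq_mul (leqnn d.+1) (leq_divM (12 * n + 4) 11); rewrite -/y.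
by move: qy; clear; move: (p ^ k)%N y d.+1 => Q y D; move: (12 * n + 4)%N => m; nia.
Qed.
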